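(* Let $F$ and $G$ be finite groups acting transitively on $Y=F/H$ and $X=G/K$, with $H$ the stabilizer of $y_0\in Y$ and $K$ the stabilizer of $x_0\in X$. Let $\mathcal{P}$ be a $G$-invariant partition of $X$ and $\mathcal{Q}$ an $F$-invariant partition of $Y$, and assume that $N=\{u\in F:uB=B\ \text{for all }B\in\mathcal{Q}\}$ is transitive on every $B\in\mathcal{Q}$. Let $L(X)=\bigoplus_{\omega\in\Omega}a_\omega V_\omega$, $L(Y)=\bigoplus_{\delta\in\Delta}b_\delta W_\delta$ and $L(A_0)=\bigoplus_{\gamma\in\Gamma}c_\gamma U_\gamma$ be the decompositions into irreducible representations of $G$, $F$ and $T$ respectively, where $A_0$ is the part of $\mathcal{P}$ containing $x_0$ and $T$ is the stabilizer of $A_0$ in $G$. Let $\Delta_0\subseteq\Delta$ be the subset such that $L(\mathcal{Q})=\bigoplus_{\delta\in\Delta_0}b_\delta W_\delta$. Then $$L(X\times Y)=\left[\bigoplus_{\omega\in\Omega}\bigoplus_{\delta\in\Delta_0}a_\omega b_\delta\,(V_\omega\otimes W_\delta)\right]\bigoplus\left\{\bigoplus_{\gamma\in\Gamma}\bigoplus_{\delta\in\Delta\setminus\Delta_0}c_\gamma b_\delta\left[\left(\mathrm{Ind}_T^GU_\gamma\right)\otimes W_\delta\right]\right\}$$ is the decomposition of $L(X\times Y)$ into irreducible representations of the crested product $(N^{\mathcal{P}}\cdot F^{\mathrm{diag}})\ltimes G$.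
   Context: For a finite set $Z$, $L(Z)$ is the space of complex functions on $Z$ with $\langle f_1,f_2\rangle=\sum_z f_1(z)\overline{f_2(z)}$, with permutation action if a group acts on $Z$; $L(X\times Y)$ is identified with $L(X)\otimes L(Y)$. A ''decomposition into irreducible representations'' $\bigoplus_i m_iW_i$ means the isotypic decomposition: the $W_i$ are irreducible, pairwise inequivalent, and $m_i$ is the multiplicity of $W_i$. A partition of a $G$-set is $G$-invariant if $G$ permutes its parts. $L(\mathcal{Q})$ is identified with the space of functions in $L(Y)$ that are constant on each part of $\mathcal{Q}$; under the hypothesis on $N$, an irreducible $F$-representation contained in $L(\mathcal{Q})$ is never equivalent to one contained in the orthogonal complement of $L(\mathcal{Q})$ in $L(Y)$, so $\Delta_0$ exists. $L(A_0)$ is the space of functions in $L(X)$ supported on $A_0$, and $\mathrm{Ind}_T^GU_\gamma$ is realized, for each copy of $U_\gamma$ in $L(A_0)$, as the subspace $\bigoplus_l lU_\gamma$ of $L(X)$, $l$ running over representatives of the cosets $lT$ of $T$ in $G$. The spaces $V_\omega\otimes W_\delta$ and $(\mathrm{Ind}_T^GU_\gamma)\otimes W_\delta$ are subspaces of $L(X)\otimes L(Y)=L(X\times Y)$, with the action of the crested product inherited from $L(X\times Y)$. The wreath product $F\wr G=F^X\ltimes G$ is the set of pairs $(f,g)$, $f:X\to F$, $g\in G$, with $(f,g)(f_1,g_1)=(f\cdot gf_1,gg_1)$, $(f\cdot gf_1)(x)=f(x)f_1(g^{-1}x)$. It acts on $X\times Y$ by the composition action $(f,g)(x,y)=(gx,f(gx)y)$.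 $F^{\mathrm{diag}}$ is the group of constant functions $X\to F$, $N^{\mathcal{P}}$ the group of functions $X\to N$ constant on each part of $\mathcal{P}$. The crested product $(N^{\mathcal{P}}\cdot F^{\mathrm{diag}})\ltimes G$ is the subgroup of $F\wr G$ of all $(f,g)$ with $f\in N^{\mathcal{P}}\cdot F^{\mathrm{diag}}$; it acts on $X\times Y$ as a subgroup of $F\wr G$. *)

(* Defs.v *)
From HB Require Import structures.
From mathcomp Require Import all_boot all_order all_algebra all_fingroup.

Set Implicit Arguments.
Unset Strict Implicit.
Unset Printing Implicit Defensive.

Import GRing.Theory Num.Theory.

(* MathComp actions are right actions: [to x (a * b) = to (to x a) b]. Left
   actions are encoded by [g . z = to z g^-1]; [action_of_left] shows that
   every left action arises in this way. *)

Section LeftActions.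
Local Open Scope group_scope.
Variables (gT : finGroupType) (Z : finType).

Definition lact (to : {action gT &-> Z}) (g : gT) (z : Z) : Z := to z g^-1.

Lemma lact1 to z : lact to 1 z = z.
Proof. by rewrite /lact invg1 act1. Qed.

Lemma lactM to g h z : lact to (g * h) z = lact to g (lact to h z).
Proof. by rewrite /lact invMg actM. Qed.

Lemma lactK to g : cancel (lact to g) (lact to g^-1).
Proof. by move=> z; rewrite -lactM mulVg lact1. Qed.

Variable la : gT -> Z -> Z.
Hypothesis la1 : forall z, la 1 z = z.
Hypothesis laM : forall g h z, la (g * h) z = la g (la h z).

Fact action_of_left1 z : la 1^-1 z = z.
Proof. by rewrite invg1 la1. Qed.

Fact action_of_leftM z : act_morph (fun z g => la g^-1 z) z.
Proof. by move=> g h; rewrite invMg laM. Qed.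

Definition action_of_left : {action gT &-> Z} :=
  TotalAction action_of_left1 action_of_leftM.

Lemma lact_of_left g z : lact action_of_left g z = la g z.
Proof. by rewrite /lact /= invgK. Qed.

End LeftActions.

Section Wreath.
Local Open Scope group_scope.
Variables (gT fT : finGroupType) (X Y : finType).

(* The action [toX] is a phantom parameter: the group law depends on it. *)
Record wreath (toX : {action gT &-> X}) : Type :=
  Wreath { wr_base : {ffun X -> fT}; wr_top : gT }.

Variables (toX : {action gT &-> X}) (toY : {action fT &-> Y}).
Local Notation wr := (wreath toX).
Implicit Types w : wr.

Definition wr_pair w := (wr_base w, wr_top w).
Definition pair_wr p : wr := Wreath toX p.1 p.2.

Fact wr_pairK : cancel wr_pair pair_wr.
Proof. by case. Qed.

HB.instance Definition _ := Finite.copy wr (can_type wr_pairK).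

Definition wr_mul w w1 : wr :=
  Wreath toX [ffun x => wr_base w x * wr_base w1 (lact toX (wr_top w)^-1 x)]
    (wr_top w * wr_top w1).

Definition wr_one : wr := Wreath toX [ffun=> 1] 1.

Definition wr_inv w : wr :=
  Wreath toX [ffun x => (wr_base w (lact toX (wr_top w) x))^-1] (wr_top w)^-1.

Fact wr_mulA : associative wr_mul.
Proof.
move=> [f g] [f1 g1] [f2 g2]; congr Wreath => /=; last exact: mulgA.
by apply/ffunP=> x; rewrite !ffunE /= invMg lactM mulgA.
Qed.

Fact wr_mul1 : left_id wr_one wr_mul.
Proof.
move=> [f g]; congr Wreath => /=; last exact: mul1g.
by apply/ffunP=> x; rewrite !ffunE /= invg1 lact1 mul1g.
Qed.

Fact wr_mulV : left_inverse wr_one wr_inv wr_mul.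
Proof.
move=> [f g]; congr Wreath => /=; last exact: mulVg.
by apply/ffunP=> x; rewrite !ffunE /= invgK mulVg.
Qed.

HB.instance Definition _ := Finite_isGroup.Build wr wr_mulA wr_mul1 wr_mulV.

Definition wr_lact (w : wr) (z : X * Y) : X * Y :=
  let gx := lact toX (wr_top w) z.1 in (gx, lact toY (wr_base w gx) z.2).

Fact wr_lact1 z : wr_lact 1 z = z.
Proof. by case: z => x y; rewrite /wr_lact /= ffunE !lact1. Qed.

Fact wr_lactM w w1 z : wr_lact (w * w1) z = wr_lact w (wr_lact w1 z).
Proof.
by rewrite /wr_lact /= ffunE lactM lactK lactM.
Qed.

Definition wr_action : {action wr &-> X * Y} :=
  action_of_left wr_lact1 wr_lactM.

End Wreath.

Arguments wreath {gT} fT {X} toX.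

Section Crested.
Local Open Scope group_scope.
Variables (gT fT : finGroupType) (X : finType) (toX : {action gT &-> X}).
Variables (N : {set fT}) (P : {set {set X}}).

Definition diag_functions : {set {ffun X -> fT}} :=
  [set [ffun=> u] | u in [set: fT]].

Definition partwise_functions : {set {ffun X -> fT}} :=
  [set f : {ffun X -> fT} | [forall x, f x \in N]
     & [forall A in P, forall x in A, forall x' in A, f x == f x']].

Definition crested_base : {set {ffun X -> fT}} :=
  [set [ffun x => h x * d x]
     | h : {ffun X -> fT} in partwise_functions,
       d : {ffun X -> fT} in diag_functions].

Definition crested : {set wreath fT toX} :=
  [set w | wr_base w \in crested_base].

End Crested.

Section CrestedGroup.
Local Open Scope group_scope.
Variables (gT fT : finGroupType) (X : finType) (toX : {action gT &-> X}).
Variables (N : {group fT}) (P : {set {set X}}).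

Lemma crested_baseP (f : {ffun X -> fT}) :
  reflect (exists h u, [/\ forall x, h x \in N,
             forall A x x', A \in P -> x \in A -> x' \in A -> h x = h x' :> fT
           & forall x, f x = h x * u])
    (f \in crested_base N P).
Proof.
apply: (iffP imset2P) => [[h d] | [h [u [hN hP fE]]]].
  rewrite inE => /andP[/forallP hN /forall_inP hP] /imsetP[u _ ->] ->.
  exists h, u; split=> // [A x x' /hP/forall_inP hA /hA/forall_inP hx /hx/eqP //|x].
  by rewrite !ffunE.
exists (finfun h) [ffun=> u].
- rewrite inE; apply/andP; split; first by apply/forallP=> x; rewrite ffunE.
  apply/forall_inP=> A PA; apply/forall_inP=> x Ax; apply/forall_inP=> x' Ax'.
  by rewrite !ffunE (hP A x x').
- by apply/imsetP; exists u.
by apply/ffunP=> x; rewrite !ffunE fE.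
Qed.

Lemma crested_group_set :
  N <| [set: fT] -> [acts [set: gT], on P | toX^*] ->
  group_set (crested toX N P).
Proof.
move=> nN aP; apply/group_setP; split.
  rewrite inE; apply/crested_baseP; exists (fun=> 1), 1.
  by split=> // x; rewrite ffunE mulg1.
move=> [f g] [f1 g1]; rewrite !inE /=.
move=> /crested_baseP[h [u [hN hP fE]]] /crested_baseP[h1 [u1 [h1N h1P f1E]]].
pose k x := h1 (lact toX g^-1 x) ^ u^-1.
apply/crested_baseP; exists (fun x => h x * k x), (u * u1); split=> [x|A x x' PA Ax Ax'|x].
- rewrite groupM // memJ_norm //.
  by have /subsetP := normal_norm nN; apply; rewrite inE.
- rewrite (hP A x x') // /k (h1P (toX^* A g)%act (lact toX g^-1 x) (lact toX g^-1 x')) //.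
  + by rewrite (acts_act aP) ?inE.
  + by rewrite /lact invgK; apply: imset_f.
  + by rewrite /lact invgK; apply: imset_f.
by rewrite ffunE fE f1E /k conjgE invgK !mulgA mulgKV.
Qed.

End CrestedGroup.

Local Open Scope ring_scope.

Section Representations.
Variables (C : fieldType) (V : vectType C) (gT : finGroupType).
Variables (D : {set gT}) (r : gT -> 'End(V)).

Definition stable (U : {vspace V}) : Prop :=
  {in D, forall g, (r g @: U <= U)%VS}.

Definition irreducible (U : {vspace V}) : Prop :=
  [/\ U != 0%VS, stable U
    & forall U' : {vspace V}, stable U' -> (U' <= U)%VS ->
        U' = 0%VS \/ U' = U].

Definition equivalent (U U' : {vspace V}) : Prop :=
  exists phi : 'End(V),
    [/\ (phi @: U = U')%VS, (U :&: lker phi = 0)%VS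
      & {in D & U, forall g u, phi (r g u) = r g (phi u)}].

(* [W i] lists the [m i] copies of the i-th irreducible representation whose
   direct sum is the i-th isotypic component of [S]. *)
Definition isotypic_decomposition (S : {vspace V})
    (I : finType) (m : I -> nat) (W : I -> seq {vspace V}) : Prop :=
  [/\ forall i, (0 < m i)%N /\ size (W i) = m i,
      forall i, {in W i, forall U, irreducible U},
      forall i j, {in W i & W j, forall U U', equivalent U U' <-> i = j},
      directv (\sum_i \sum_(U <- W i) U)
    & S = (\sum_i \sum_(U <- W i) U)%VS].

End Representations.

(* The scalars range over all algebraically closed fields with a conjugation
   ([numClosedFieldType]), of which the complex numbers are an instance. *)
Notation funsp C Z := {ffun Z%type -> C^o}.

Section FunctionSpaces.
Variables (C : numClosedFieldType) (Z : finType).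
Local Notation L := (funsp C Z).

Definition evalf (z : Z) (f : L) : C^o := f z.

Fact evalf_is_linear z : linear (evalf z).
Proof. by move=> a f f'; rewrite /evalf !ffunE. Qed.

HB.instance Definition _ z :=
  GRing.isLinear.Build C L C^o _ (evalf z) (evalf_is_linear z).

Definition eval_at (z : Z) : 'Hom(L, C^o) := linfun (evalf z).

Lemma eval_atE z f : eval_at z f = f z.
Proof. by rewrite lfunE. Qed.

Definition supported_on (A : {set Z}) : {vspace L} :=
  (\bigcap_(z | z \notin A) lker (eval_at z))%VS.

Lemma supported_onP (A : {set Z}) (f : L) :
  reflect (forall z, z \notin A -> f z = 0) (f \in supported_on A).
Proof.
rewrite memvE; apply: (iffP subv_bigcapP) => h z zA.
  by have := h z zA; rewrite -memvE memv_ker eval_atE => /eqP.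
by rewrite -memvE memv_ker eval_atE h.
Qed.

Definition constant_on_parts (Q : {set {set Z}}) : {vspace L} :=
  (\bigcap_(B in Q) \bigcap_(z in B) \bigcap_(z' in B)
     lker (eval_at z - eval_at z'))%VS.

Lemma constant_on_partsP (Q : {set {set Z}}) (f : L) :
  reflect (forall B z z', B \in Q -> z \in B -> z' \in B -> f z = f z')
    (f \in constant_on_parts Q).
Proof.
rewrite memvE; apply: (iffP subv_bigcapP) => [h B z z' BQ zB z'B | h B BQ].
  have /subv_bigcapP h1 := h B BQ; have /subv_bigcapP h2 := h1 z zB.
  move: (h2 z' z'B).
  by rewrite -memvE memv_ker add_lfunE opp_lfunE !eval_atE subr_eq0 => /eqP.
apply/subv_bigcapP=> z zB; apply/subv_bigcapP=> z' z'B.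
rewrite -memvE memv_ker add_lfunE opp_lfunE !eval_atE subr_eq0; apply/eqP.
exact: h z'B.
Qed.

Variables (gT : finGroupType) (to : {action gT &-> Z}).

Definition perm_fun (g : gT) (f : L) : L := [ffun z => f (lact to g^-1%g z)].

Fact perm_fun_is_linear g : linear (perm_fun g).
Proof. by move=> a f f'; apply/ffunP=> z; rewrite !ffunE. Qed.

HB.instance Definition _ g :=
  GRing.isLinear.Build C L L _ (perm_fun g) (perm_fun_is_linear g).

Definition perm_rep (g : gT) : 'End(L) := linfun (perm_fun g).

Lemma perm_repE g f z : perm_rep g f z = f (lact to g^-1%g z).
Proof. by rewrite lfunE ffunE. Qed.

Lemma perm_rep1 f : perm_rep 1%g f = f.
Proof. by apply/ffunP=> z; rewrite perm_repE invg1 lact1. Qed.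

Lemma perm_repM g h f : perm_rep (g * h)%g f = perm_rep g (perm_rep h f).
Proof. by apply/ffunP=> z; rewrite !perm_repE invMg lactM. Qed.

(* [repr c] is a representative [l] of the coset [c = lT]. For U inside
   L(A_0) and T the stabilizer of the part A_0, the sum is direct since the
   summands lU are supported on the distinct parts lA_0. *)
Definition induced (T : {set gT}) (U : {vspace L}) : {vspace L} :=
  (\sum_(c in lcosets T [set: gT]) (perm_rep (repr c) @: U))%VS.

End FunctionSpaces.

Arguments supported_on C {Z} A.
Arguments constant_on_parts C {Z} Q.
Arguments perm_rep C {Z gT} to g.

Section Tensor.
Variables (C : numClosedFieldType) (X Y : finType).

Definition tensf (f : funsp C X) (h : funsp C Y) : funsp C (X * Y) :=
  [ffun z => f z.1 * h z.2].

Definition tensv (V : {vspace funsp C X}) (W : {vspace funsp C Y}) :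
    {vspace funsp C (X * Y)} :=
  <<[seq tensf f h | f <- vbasis V, h <- vbasis W]>>%VS.

Lemma tensvP (V : {vspace funsp C X}) (W : {vspace funsp C Y})
    (U : {vspace funsp C (X * Y)}) :
  reflect {in V & W, forall f h, tensf f h \in U} (tensv V W <= U)%VS.
Proof.
apply: (iffP span_subvP) => [sub f h fV hW | sub _ /allpairsP[[f h] /= [fV hW ->]]].
  have -> : tensf f h = \sum_i \sum_j
      (coord (vbasis V) i f * coord (vbasis W) j h)
        *: tensf (vbasis V)`_i (vbasis W)`_j.
    apply/ffunP=> z; rewrite ffunE {1}(coord_vbasis fV) {1}(coord_vbasis hW).
    rewrite !sum_ffunE mulr_suml; apply: eq_bigr => i _.
    rewrite mulr_sumr sum_ffunE; apply: eq_bigr => j _.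
    rewrite !ffunE /GRing.scale /=.
    by rewrite mulrACA.
  apply: memv_suml => i _; apply: memv_suml => j _; apply/memvZ/sub.
  by apply: allpairs_f; rewrite mem_nth // size_tuple.
by apply: sub; apply: vbasis_mem.
Qed.

End Tensor.

(* Main.v *)
From HB Require Import structures.
Require Import Defs.
From mathcomp Require Import all_boot all_order all_algebra all_fingroup.
From Stdlib Require Import Classical_Prop.

Set Implicit Arguments.
Unset Strict Implicit.
Unset Printing Implicit Defensive.

Import GRing.Theory Num.Theory.
Local Open Scope ring_scope.

(** Write E for the crested product and L(Q) for the functions on Y that are
    constant on the parts of Q.  As N is transitive on each part, L(Q) is the
    space of N-invariants of L(Y).  An irreducible F-subspace W of L(Y)
    therefore either lies in L(Q), and N acts trivially on it, or contains no
    non-zero N-invariant vector.  The two halves of the decomposition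
    correspond to these two cases.

    If W lies in L(Q), an element (h u, g) of E, with h in N^P and u in F, acts
    on V (x) W as g (x) u ([crested_acts_diagonally]).  So E acts on V (x) W
    through G x F, and the usual theory of outer tensor products applies:
    V (x) W is irreducible ([tensor_irreducible]) and determines the classes
    of V and W ([tensor_intertwiner]).

    If W has no N-invariants, applying to a non-zero vector s of a stable
    subspace S of Ind U (x) W the elements of E that act as n in N over a
    single part of P and trivially over the others, and subtracting s, gives
    vectors of S that live over that part, and not all of them vanish.  After a
    translation by G the part is A0, so S meets U (x) W.  There the first
    argument applies again, with the stabilizer T of A0 in place of G: S
    contains U (x) W, hence its translates, hence everything
    ([tensv_induced_irreducible]).  For the same reason a vector that is fixed
    by these elements over all parts but A0 lives over A0, so an intertwiner
    between two such spaces maps U (x) W to U' (x) W', and the classes of U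
    and W can be recovered ([tensv_induced_factors]).  A space of the first
    kind is not equivalent to one of the second kind, as the constant
    functions with value in N act trivially on the former and without
    invariants on the latter.

    That the summands span L(X x Y) is bilinearity, given that
    L(X) = \sum_g g L(A0).  That their sum is direct is a count of dimensions:
    they add up to at most #|X| * #|Y|.

    All of this is computed with the rows s(x, -) and the columns s(-, y) of
    a function s on X x Y: s lies in V (x) W if and only if its rows lie in W
    and its columns in V ([tensv_slicesP]), and on a row an element of the
    wreath product acts through a single element of F ([row_wr_rep]). *)

(** * Schur's lemma for subspaces *)

Section Stable.
Variables (C : fieldType) (V : vectType C) (gT : finGroupType).
Variables (D : {set gT}) (r : gT -> 'End(V)).

Lemma stableP (U : {vspace V}) :
  stable D r U <-> {in D & U, forall g u, r g u \in U}.
Proof.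
split=> [st g u Dg Uu | st g Dg].
  by apply: (subvP (st g Dg)); apply: memv_img.
by apply/subvP=> _ /memv_imgP[u Uu ->]; apply: st.
Qed.

Lemma stable_cap (U U' : {vspace V}) :
  stable D r U -> stable D r U' -> stable D r (U :&: U')%VS.
Proof.
move=> /stableP st /stableP st'; apply/stableP=> g u Dg /memv_capP[Uu U'u].
by rewrite memv_cap st ?st'.
Qed.

(** The intersection with the stable subspace is stable and contains u. *)
Lemma irreducible_sub (U U' : {vspace V}) :
    irreducible D r U -> stable D r U' ->
  forall u, u != 0 -> u \in U -> u \in U' -> (U <= U')%VS.
Proof.
move=> [_ stU irrU] stU' u u0 Uu U'u.
have [UU'0 | <-] := irrU _ (stable_cap stU stU') (capvSl _ _); last exact: capvSr.
have: u \in (U :&: U')%VS by rewrite memv_cap Uu.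
by rewrite UU'0 memv0 (negPf u0).
Qed.

(** A stable subspace that is not irreducible has a smaller non-zero stable
    subspace, so induction on the dimension applies.  Over an abstract field
    the existence of such a subspace is only decided classically. *)
Lemma stable_irreducible (U : {vspace V}) :
    stable D r U -> U != 0%VS ->
  exists2 U0, irreducible D r U0 & (U0 <= U)%VS.
Proof.
have [n] := ubnP (\dim U); elim: n U => // n IHn U leUn stU U0.
case: (classic (exists U', [/\ stable D r U', (U' <= U)%VS, U' != 0%VS & U' != U])).
  move=> [U' [stU' sub U'0 U'U]].
  have ltU': (\dim U' < n)%N.
    by rewrite -ltnS (leq_trans _ leUn) // ltnS (ltn_leqif (dimv_leqif_eq sub)).
  have [U1 ? sub1] := IHn U' ltU' stU' U'0.
  by exists U1 => //; apply: subv_trans sub.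
move=> nex; exists U => //; split=> // U' stU' sub.
have [->|U'0] := eqVneq U' 0%VS; [by left | right].
by have [//|U'U] := eqVneq U' U; case: nex; exists U'.
Qed.

End Stable.

Section Schur.
Variables (C : fieldType) (V1 V2 : vectType C) (gT : finGroupType).
Variables (D : {set gT}) (r1 : gT -> 'End(V1)) (r2 : gT -> 'End(V2)).

Definition intertwines (U : {vspace V1}) (phi : 'Hom(V1, V2)) : Prop :=
  {in D & U, forall g u, phi (r1 g u) = r2 g (phi u)}.

Lemma intertwiner_kernel (U : {vspace V1}) (phi : 'Hom(V1, V2)) :
    irreducible D r1 U -> intertwines U phi ->
  (U <= lker phi)%VS \/ (U :&: lker phi = 0)%VS.
Proof.
move=> [_ /stableP stU irrU] eqv.
have st: stable D r1 (U :&: lker phi)%VS.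
  apply/stableP=> g u Dg /memv_capP[Uu]; rewrite memv_ker => /eqP phiu0.
  by rewrite memv_cap stU // memv_ker eqv // phiu0 linear0 /=.
have [->|<-] := irrU _ st (capvSl _ _); [by right | left; exact: capvSr].
Qed.

Lemma intertwiner_image (U : {vspace V1}) (phi : 'Hom(V1, V2)) :
  stable D r1 U -> intertwines U phi -> stable D r2 (phi @: U)%VS.
Proof.
move=> /stableP st eqv; apply/stableP=> g _ Dg /memv_imgP[u Uu ->].
by rewrite -eqv // memv_img // st.
Qed.

Lemma schur (U : {vspace V1}) (U' : {vspace V2}) (phi : 'Hom(V1, V2)) :
    irreducible D r1 U -> irreducible D r2 U' -> intertwines U phi ->
    (phi @: U <= U')%VS -> forall u, u \in U -> phi u != 0 ->
  (phi @: U = U')%VS /\ (U :&: lker phi = 0)%VS.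
Proof.
move=> irrU [_ _ irrU'] eqv sub u Uu phiu0; split.
  have [_ stU _] := irrU.
  have [im0|//] := irrU' _ (intertwiner_image stU eqv) sub.
  by have := memv_img phi Uu; rewrite im0 memv0 (negPf phiu0).
have [/subvP/(_ u Uu) | //] := intertwiner_kernel irrU eqv.
by rewrite memv_ker (negPf phiu0).
Qed.

End Schur.

(** As phi is bijective from U to U', phi^-1 psi is an endomorphism of U and has
    an eigenvalue k.  The kernel of the intertwiner psi - k phi meets U, hence
    contains it. *)
Lemma schur_scalar (C : numClosedFieldType) (V1 V2 : vectType C)
    (gT : finGroupType) (D : {set gT}) (r1 : gT -> 'End(V1)) (r2 : gT -> 'End(V2))
    (U : {vspace V1}) (U' : {vspace V2}) (phi psi : 'Hom(V1, V2)) :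
    irreducible D r1 U -> irreducible D r2 U' ->
    intertwines D r1 r2 U phi -> intertwines D r1 r2 U psi ->
    (phi @: U <= U')%VS -> (psi @: U <= U')%VS ->
    forall u0, u0 \in U -> phi u0 != 0 ->
  exists k, {in U, forall u, psi u = k *: phi u}.
Proof.
move=> irrU irrU' eqphi eqpsi subphi subpsi u0 Uu0 phiu0.
have [im ker0] := schur irrU irrU' eqphi subphi Uu0 phiu0.
have /fin_all_exists[w wE] : forall i : 'I_(\dim U),
    exists w, w \in U /\ psi (vbasis U)`_i = phi w.
  move=> i; have: psi (vbasis U)`_i \in (phi @: U)%VS.
    rewrite im; apply: (subvP subpsi); apply: memv_img.
    by apply: vbasis_mem; rewrite mem_nth // size_tuple.
  by case/memv_imgP=> w Uw ->; exists w.
(* A is the matrix of (phi^-1) \o psi on U. *)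
pose A := \matrix_(i, j) coord (vbasis U) j (w i).
have [|k /eigenvalueP[v vA v0]] := spectral.eigenvalue_closed A.
  by rewrite lt0n dimv_eq0; case: irrU.
pose u := \sum_i v 0 i *: (vbasis U)`_i.
have Uu : u \in U.
  apply: memv_suml => i _; apply/memvZ/vbasis_mem.
  by rewrite mem_nth // size_tuple.
have uE : psi u = k *: phi u.
  have -> : psi u = phi (\sum_i v 0 i *: w i).
    by rewrite !linear_sum; apply: eq_bigr => i _; rewrite !linearZ /= (wE i).2.
  have -> : k *: phi u = phi (\sum_i (k *: v) 0 i *: (vbasis U)`_i).
    rewrite -linearZ scaler_sumr; congr (phi _); apply: eq_bigr => i _.
    by rewrite mxE scalerA.
  congr (phi _); rewrite -vA.
  rewrite (eq_bigr (fun i => \sum_j (v 0 i * A i j) *: (vbasis U)`_j)); last first.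
    move=> i _; rewrite {1}(coord_vbasis (wE i).1) scaler_sumr.
    by apply: eq_bigr => j _; rewrite mxE scalerA.
  rewrite exchange_big; apply: eq_bigr => j _ /=.
  by rewrite mxE scaler_suml.
have un0 : u != 0.
  apply: contra_neq v0 => /eqP; rewrite /u => /eqP u00.
  apply/rowP=> i; rewrite mxE.
  by have /freeP/(_ (fun i => v 0 i) u00 i) := basis_free (vbasisP U).
exists k => u1 Uu1.
pose chi := psi - k *: phi.
have chiE x : chi x = psi x - k *: phi x by rewrite /chi !lfun_simp.
have eqchi : intertwines D r1 r2 U chi.
  move=> g x Dg Ux; rewrite !chiE eqphi // eqpsi //.
  by rewrite -[k *: r2 g _]linearZ -linearB.
have [sub|cap0] := intertwiner_kernel irrU eqchi.
  by have /subvP/(_ _ Uu1) := sub; rewrite memv_ker chiE subr_eq0 => /eqP.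
have : u \in (U :&: lker chi)%VS by rewrite memv_cap Uu memv_ker chiE uE subrr eqxx.
by rewrite cap0 memv0 (negPf un0).
Qed.

Lemma equivalent_neq0 (F : fieldType) (vT : vectType F) (U : {vspace vT})
    (phi : 'End(vT)) u :
  (U :&: lker phi = 0)%VS -> u \in U -> u != 0 -> phi u != 0.
Proof.
move=> ker0 Uu; rewrite -memv_ker; apply: contraNN => ku.
by rewrite -memv0 -ker0 memv_cap Uu.
Qed.

(** * Rows and columns of a function on a product *)

Section Slices.
Variables (C : numClosedFieldType) (X Y : finType).
Local Notation LX := (funsp C X).
Local Notation LY := (funsp C Y).
Local Notation LXY := (funsp C (X * Y)).

Definition rowf (x : X) (s : LXY) : LY := [ffun y => s (x, y)].
Definition colf (y : Y) (s : LXY) : LX := [ffun x => s (x, y)].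
(** The operators 1 (x) psi and phi (x) 1 on L(X) (x) L(Y). *)
Definition map_rowsf (psi : 'End(LY)) (s : LXY) : LXY :=
  [ffun z => psi (rowf z.1 s) z.2].
Definition map_colsf (phi : 'End(LX)) (s : LXY) : LXY :=
  [ffun z => phi (colf z.2 s) z.1].

Fact rowf_is_linear x : linear (rowf x).
Proof. by move=> k s s'; apply/ffunP=> y; rewrite !ffunE. Qed.
HB.instance Definition _ x :=
  GRing.isLinear.Build C LXY LY _ (rowf x) (rowf_is_linear x).

Fact colf_is_linear y : linear (colf y).
Proof. by move=> k s s'; apply/ffunP=> x; rewrite !ffunE. Qed.
HB.instance Definition _ y :=
  GRing.isLinear.Build C LXY LX _ (colf y) (colf_is_linear y).

Fact map_rowsf_is_linear psi : linear (map_rowsf psi).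
Proof. by move=> k s s'; apply/ffunP=> z; rewrite !ffunE !linearP !ffunE. Qed.
HB.instance Definition _ psi :=
  GRing.isLinear.Build C LXY LXY _ (map_rowsf psi) (map_rowsf_is_linear psi).

Fact map_colsf_is_linear phi : linear (map_colsf phi).
Proof. by move=> k s s'; apply/ffunP=> z; rewrite !ffunE !linearP !ffunE. Qed.
HB.instance Definition _ phi :=
  GRing.isLinear.Build C LXY LXY _ (map_colsf phi) (map_colsf_is_linear phi).

Definition tensf_l (h : LY) (f : LX) : LXY := tensf f h.

Fact tensf_is_linear_l (h : LY) : linear (tensf_l h).
Proof. by move=> k f f'; apply/ffunP=> z; rewrite !ffunE mulrDl scalerAl. Qed.
HB.instance Definition _ h :=
  GRing.isLinear.Build C LX LXY _ (tensf_l h) (tensf_is_linear_l h).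

Fact tensf_is_linear_r (f : LX) : linear (@tensf C X Y f).
Proof. by move=> k h h'; apply/ffunP=> z; rewrite !ffunE mulrDr scalerAr. Qed.
HB.instance Definition _ f :=
  GRing.isLinear.Build C LY LXY _ (tensf f) (tensf_is_linear_r f).

Definition row_at x : 'Hom(LXY, LY) := linfun (rowf x).
Definition col_at y : 'Hom(LXY, LX) := linfun (colf y).
Definition map_rows psi : 'End(LXY) := linfun (map_rowsf psi).
Definition map_cols phi : 'End(LXY) := linfun (map_colsf phi).
Definition tens_l h : 'Hom(LX, LXY) := linfun (tensf_l h).
Definition tens_r f : 'Hom(LY, LXY) := linfun (@tensf C X Y f).

Lemma row_atE x s y : row_at x s y = s (x, y).
Proof. by rewrite lfunE ffunE. Qed.
Lemma col_atE y s x : col_at y s x = s (x, y).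
Proof. by rewrite lfunE ffunE. Qed.
Lemma map_rowsE psi s z : map_rows psi s z = psi (row_at z.1 s) z.2.
Proof. by rewrite lfunE ffunE /= lfunE. Qed.
Lemma map_colsE phi s z : map_cols phi s z = phi (col_at z.2 s) z.1.
Proof. by rewrite lfunE ffunE /= lfunE. Qed.
Lemma tens_lE (h : LY) (f : LX) : tens_l h f = tensf f h.
Proof. by rewrite lfunE. Qed.
Lemma tens_rE (f : LX) (h : LY) : tens_r f h = tensf f h.
Proof. by rewrite lfunE. Qed.

Lemma row_tensf x (f : LX) (h : LY) : row_at x (tensf f h) = f x *: h.
Proof. by apply/ffunP=> y; rewrite row_atE !ffunE. Qed.
Lemma col_tensf y (f : LX) (h : LY) : col_at y (tensf f h) = h y *: f.
Proof. by apply/ffunP=> x; rewrite col_atE !ffunE /= mulrC. Qed.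

Lemma row_map_rows psi s x : row_at x (map_rows psi s) = psi (row_at x s).
Proof. by apply/ffunP=> y; rewrite row_atE map_rowsE. Qed.
Lemma col_map_cols phi s y : col_at y (map_cols phi s) = phi (col_at y s).
Proof. by apply/ffunP=> x; rewrite col_atE map_colsE. Qed.

Lemma map_rows_tensf psi (f : LX) (h : LY) :
  map_rows psi (tensf f h) = tensf f (psi h).
Proof.
by apply/ffunP=> z; rewrite map_rowsE row_tensf linearZ /= !ffunE.
Qed.
Lemma map_cols_tensf phi (f : LX) (h : LY) :
  map_cols phi (tensf f h) = tensf (phi f) h.
Proof.
by apply/ffunP=> z; rewrite map_colsE col_tensf linearZ /= !ffunE /= mulrC.
Qed.

Lemma ffun_neq0P (Z : finType) (f : funsp C Z) :
  reflect (exists z, f z != 0) (f != 0).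
Proof.
apply: (iffP idP) => [s0 | [z]]; last by apply: contraNneq => ->; rewrite ffunE.
apply/existsP; apply: contraR s0; rewrite negb_exists => /forallP f0.
by apply/eqP/ffunP=> z; rewrite ffunE; apply/eqP; have := f0 z; rewrite negbK.
Qed.

Lemma neq0_rowP (s : LXY) : reflect (exists x, row_at x s != 0) (s != 0).
Proof.
apply: (iffP idP) => [s0 | [x]]; last by apply: contraNneq => ->; rewrite linear0.
apply/existsP; apply: contraR s0; rewrite negb_exists => /forallP rows0.
apply/eqP/ffunP=> -[x y]; rewrite -row_atE ffunE.
by have := rows0 x; rewrite negbK => /eqP->; rewrite ffunE.
Qed.

Lemma tensf_eq0 (f : LX) (h : LY) : (tensf f h == 0) = (f == 0) || (h == 0).
Proof.
apply/idP/idP => [|/orP[/eqP->|/eqP->]]; first last.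
- by apply/eqP/ffunP=> z; rewrite !ffunE mulr0.
- by apply/eqP/ffunP=> z; rewrite !ffunE mul0r.
apply: contraTT => /norP[/ffun_neq0P[x fx] /ffun_neq0P[y hy]].
by apply/ffun_neq0P; exists (x, y); rewrite ffunE mulf_neq0.
Qed.

Lemma mem_tensf (V : {vspace LX}) (W : {vspace LY}) f h :
  f \in V -> h \in W -> tensf f h \in tensv V W.
Proof. by move=> Vf Wh; apply: (tensvP _ _ _ (subvv (tensv V W))). Qed.

Lemma tensv_neq0 (V : {vspace LX}) (W : {vspace LY}) :
  V != 0%VS -> W != 0%VS -> tensv V W != 0%VS.
Proof.
rewrite -(vpick0 V) -(vpick0 W) => V0 W0.
apply: contraTneq (mem_tensf (memv_pick V) (memv_pick W)) => ->.
by rewrite memv0 tensf_eq0 negb_or V0.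
Qed.

Definition delta (Z : finType) (z : Z) : funsp C Z := [ffun z' => (z' == z)%:R].

Lemma sum_delta (Z : finType) (f : funsp C Z) : f = \sum_z f z *: delta z.
Proof.
apply/ffunP=> z; rewrite sum_ffunE (bigD1 z) //= !ffunE eqxx big1 ?addr0.
  by rewrite /GRing.scale /= mulr1.
by move=> z' z'z; rewrite !ffunE eq_sym (negPf z'z) scaler0.
Qed.

(** This is (L(X) (x) W) :&: (V (x) L(Y)) = V (x) W: projecting all columns to V
    and all rows to W does not change s, and sends each of the pure tensors
    of which s is the sum into V (x) W. *)
Lemma tensv_slicesP (V : {vspace LX}) (W : {vspace LY}) (s : LXY) :
  reflect ((forall x, row_at x s \in W) /\ (forall y, col_at y s \in V))
    (s \in tensv V W).
Proof.
apply: (iffP idP) => [sVW | [rows cols]].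
  split=> [x|y].
    rewrite memv_preim; apply: (subvP _ _ sVW); apply/tensvP=> f h Vf Wh.
    by rewrite -memv_preim row_tensf memvZ.
  rewrite memv_preim; apply: (subvP _ _ sVW); apply/tensvP=> f h Vf Wh.
  by rewrite -memv_preim col_tensf memvZ.
have -> : s = map_rows (projv W) (map_cols (projv V) s).
  have sE : map_cols (projv V) s = s.
    by apply/ffunP=> -[x y]; rewrite map_colsE /= projv_id // col_atE.
  by apply/ffunP=> -[x y]; rewrite sE map_rowsE /= projv_id // row_atE.
have -> : s = \sum_x tensf (delta x) (row_at x s).
  apply/ffunP=> -[x y]; rewrite sum_ffunE (bigD1 x) //= !ffunE eqxx row_atE mul1r.
  by rewrite big1 ?addr0 // => x' x'x; rewrite !ffunE eq_sym (negPf x'x) mul0r.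
rewrite !linear_sum; apply: memv_suml => x _.
by rewrite /= map_cols_tensf map_rows_tensf mem_tensf // memv_proj.
Qed.

End Slices.

Arguments row_at {C X Y} x.
Arguments col_at {C X Y} y.
Arguments map_rows {C} X {Y} psi.
Arguments map_cols {C X} Y phi.
Arguments tens_l {C} X {Y} h.
Arguments tens_r {C X} Y f.
Arguments ffun_neq0P {C Z f}.
Arguments neq0_rowP {C X Y s}.
Arguments delta C {Z} z.

(** * Tensor products of irreducible representations *)

Section Tensor.
Variables (C : numClosedFieldType) (gT fT : finGroupType) (X Y : finType).
Variables (toX : {action gT &-> X}) (toY : {action fT &-> Y}).
Local Notation LX := (funsp C X).
Local Notation LY := (funsp C Y).
Local Notation LXY := (funsp C (X * Y)).
Local Notation rX := (perm_rep C toX).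
Local Notation rY := (perm_rep C toY).
Local Notation rXY := (perm_rep C (wr_action toX toY)).

Lemma wr_repE w (s : LXY) x y :
  rXY w s (x, y) =
    s (lact toX (wr_top w)^-1%g x, lact toY (wr_base w x)^-1%g y).
Proof.
rewrite perm_repE lact_of_left /wr_lact /= ffunE.
by rewrite -{2}[wr_top w]invgK lactK.
Qed.

(** A wreath product element acts on each row by one element of F; on columns
    this fails, as different entries of a column are moved by different
    elements of F. *)
Lemma row_wr_rep w (s : LXY) x :
  row_at x (rXY w s) = rY (wr_base w x) (row_at (lact toX (wr_top w)^-1%g x) s).
Proof. by apply/ffunP=> y; rewrite row_atE wr_repE perm_repE row_atE. Qed.

(** The element of the wreath product by which (g, u) in G x F acts on
    L(X) (x) L(Y). *)
Definition diag_pair (u : fT) (g : gT) : wreath fT toX := Wreath toX [ffun=> u] g.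

Lemma col_diag_pair u g (s : LXY) y :
  col_at y (rXY (diag_pair u g) s) = rX g (col_at (lact toY u^-1%g y) s).
Proof. by apply/ffunP=> x; rewrite col_atE wr_repE perm_repE col_atE ffunE. Qed.

Lemma row_diag_pair u g (s : LXY) x :
  row_at x (rXY (diag_pair u g) s) = rY u (row_at (lact toX g^-1%g x) s).
Proof. by rewrite row_wr_rep ffunE. Qed.

Lemma diag_pair_tensf u g (f : LX) (h : LY) :
  rXY (diag_pair u g) (tensf f h) = tensf (rX g f) (rY u h).
Proof.
by apply/ffunP=> -[x y]; rewrite wr_repE !ffunE /= !perm_repE.
Qed.

Variables (D : {group gT}) (V : {vspace LX}) (W : {vspace LY}).
Hypotheses (irrV : irreducible D rX V) (irrW : irreducible [set: fT] rY W).

Definition diag_stable (S : {vspace LXY}) : Prop :=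
  forall u g s, g \in D -> s \in S -> rXY (diag_pair u g) s \in S.

Lemma tensv_diag_stable : diag_stable (tensv V W).
Proof.
have [_ /stableP stV _] := irrV; have [_ /stableP stW _] := irrW.
move=> u g s Dg /tensv_slicesP[rows cols]; apply/tensv_slicesP.
by split=> [x|y]; [rewrite row_diag_pair stW ?inE | rewrite col_diag_pair stV].
Qed.

(** Take an F-irreducible S1 inside S and V (x) W.  Taking the row at x is an
    intertwiner from S1 to W, so by Schur's lemma all rows of s in S1 are
    multiples f(x) of a single one: S1 = f (x) W with f in V.  The translates of
    f (x) W under D lie in S and span V (x) W. *)
Lemma tensor_irreducible (S : {vspace LXY}) :
    diag_stable S -> forall s, s \in S -> s \in tensv V W -> s != 0 ->
  (tensv V W <= S)%VS.
Proof.
move=> stS s Ss VWs s0; pose r1 u := rXY (diag_pair u 1).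
have [S1 irrS1 subS1] : exists2 S1, irreducible [set: fT] r1 S1
    & (S1 <= S :&: tensv V W)%VS.
  apply: stable_irreducible; last first.
    apply: contraTneq s0 => SVW0; rewrite negbK -memv0 -SVW0.
    by rewrite memv_cap Ss.
  apply/stableP=> u s1 _ /memv_capP[Ss1 VWs1].
  by rewrite memv_cap stS ?tensv_diag_stable ?group1.
have S1_S s1 : s1 \in S1 -> s1 \in S by case/(subvP subS1)/memv_capP.
have S1_VW s1 : s1 \in S1 -> s1 \in tensv V W by case/(subvP subS1)/memv_capP.
have eqv x : intertwines [set: fT] r1 rY S1 (row_at x).
  by move=> u s1 _ _; rewrite row_diag_pair invg1 lact1.
have sub x : (row_at x @: S1 <= W)%VS.
  by apply/subvP=> _ /memv_imgP[s1 /S1_VW/tensv_slicesP[rows _] ->].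
have [s1 S1s1 s1_0] : exists2 s1, s1 \in S1 & s1 != 0.
  by exists (vpick S1); rewrite ?memv_pick // vpick0; case: irrS1.
have [x0 row_s1] := neq0_rowP s1_0.
have /fin_all_exists[k kE] x := schur_scalar irrS1 irrW (eqv x0) (eqv x)
  (sub x0) (sub x) S1s1 row_s1.
pose f : LX := [ffun x => k x].
have S1E s2 : s2 \in S1 -> s2 = tensf f (row_at x0 s2).
  move=> S1s2; apply/ffunP=> -[x y]; rewrite !ffunE /= -row_atE kE //.
  by rewrite !ffunE.
have [im _] := schur irrS1 irrW (eqv x0) (sub x0) S1s1 row_s1.
have Sf w : w \in W -> tensf f w \in S.
  by rewrite -im => /memv_imgP[s2 S1s2 ->]; rewrite -S1E // S1_S.
have [y0] := ffun_neq0P row_s1; set c := row_at _ _ _ => c0.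
have fV : f \in V.
  have [_ /(_ y0)] := tensv_slicesP _ _ _ (S1_VW _ S1s1).
  rewrite {1}(S1E _ S1s1) col_tensf => /(memvZ c^-1).
  by rewrite scalerA mulVf // scale1r.
have f0 : f != 0.
  by apply: contraNneq s1_0 => f0; rewrite (S1E _ S1s1) f0 tensf_eq0 eqxx.
(* The span of the D-orbit of f is stable and contains f, hence contains V. *)
pose V1 := (\sum_(g in D) <[rX g f]>)%VS.
have sVV1 : (V <= V1)%VS.
  apply: (irreducible_sub irrV _ f0 fV); last first.
    rewrite memvE (sumv_sup 1%g) ?group1 // -memvE perm_rep1; exact: memv_line.
  apply/stableP=> g v Dg V1v.
  rewrite memv_preim; apply: (subvP _ _ V1v).
  apply/subv_sumP=> h Dh; rewrite -memvE -memv_preim -perm_repM.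
  by rewrite memvE (sumv_sup (g * h)%g) ?groupM // -memvE memv_line.
apply/tensvP=> v w /(subvP sVV1) V1v Ww.
rewrite -tens_lE memv_preim; apply: (subvP _ _ V1v); apply/subv_sumP=> g Dg.
rewrite -memvE -memv_preim tens_lE -[w](perm_rep1 toY).
by rewrite -diag_pair_tensf stS // Sf.
Qed.

Lemma tensv_diag_irreducible : forall S,
  diag_stable S -> (S <= tensv V W)%VS -> S = 0%VS \/ S = tensv V W.
Proof.
move=> S stS sub; have [->|S0] := eqVneq S 0%VS; [by left | right].
apply/eqP; rewrite eqEsubv sub (tensor_irreducible stS (memv_pick S)) ?vpick0 //.
exact: (subvP sub) (memv_pick S).
Qed.

(** Choose v (x) w that phi does not kill, and a point (x, y) where its image does
    not vanish.  Then v' |-> column at y of phi (v' (x) w) and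
    w' |-> row at x of phi (v (x) w') are non-zero intertwiners. *)
Lemma tensor_intertwiner (V' : {vspace LX}) (W' : {vspace LY}) (phi : 'End(LXY)) :
    irreducible D rX V' -> irreducible [set: fT] rY W' ->
    (forall u g s, g \in D -> s \in tensv V W ->
       phi (rXY (diag_pair u g) s) = rXY (diag_pair u g) (phi s)) ->
    (phi @: tensv V W <= tensv V' W')%VS -> ~~ (tensv V W <= lker phi)%VS ->
  equivalent D rX V V' /\ equivalent [set: fT] rY W W'.
Proof.
move=> irrV' irrW' eqv sub nker.
have phi_slices v w : v \in V -> w \in W -> _ := fun Vv Ww => tensv_slicesP _ _ _
  (subvP sub _ (memv_img phi (mem_tensf Vv Ww))).
have [v [w [Vv Ww phi_vw]]] : exists v w,
    [/\ v \in V, w \in W & phi (tensf v w) != 0].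
  apply: NNPP => nex; case/negP: nker; apply/tensvP=> v w Vv Ww.
  by rewrite memv_ker; apply: contraT => ?; case: nex; exists v, w.
have [[x y]] := ffun_neq0P phi_vw => phi_vw_xy; split.
- pose psi := (col_at y \o (phi \o tens_l X w))%VF.
  have psiE v' : psi v' = col_at y (phi (tensf v' w)).
    by rewrite !comp_lfunE tens_lE.
  have eqpsi : intertwines D rX rX V psi.
    move=> g v' Dg Vv'; rewrite !psiE -[w in LHS](perm_rep1 toY) -diag_pair_tensf.
    by rewrite eqv ?mem_tensf // col_diag_pair invg1 lact1.
  have subpsi : (psi @: V <= V')%VS.
    by apply/subvP=> _ /memv_imgP[v' Vv' ->]; rewrite psiE; case: (phi_slices v' w).
  have psiv : psi v != 0.
    by apply/ffun_neq0P; exists x; rewrite psiE col_atE.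
  by have [im ker0] := schur irrV irrV' eqpsi subpsi Vv psiv; exists psi.
- pose psi := (row_at x \o (phi \o tens_r Y v))%VF.
  have psiE w' : psi w' = row_at x (phi (tensf v w')).
    by rewrite !comp_lfunE tens_rE.
  have eqpsi : intertwines [set: fT] rY rY W psi.
    move=> u w' _ Ww'; rewrite !psiE -[v in LHS](perm_rep1 toX) -diag_pair_tensf.
    by rewrite eqv ?mem_tensf ?group1 // row_diag_pair invg1 lact1.
  have subpsi : (psi @: W <= W')%VS.
    by apply/subvP=> _ /memv_imgP[w' Ww' ->]; rewrite psiE; case: (phi_slices v w').
  have psiw : psi w != 0.
    by apply/ffun_neq0P; exists y; rewrite psiE row_atE.
  by have [im ker0] := schur irrW irrW' eqpsi subpsi Ww psiw; exists psi.
Qed.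

End Tensor.

Section MapSlices.
Variables (C : numClosedFieldType) (gT fT : finGroupType) (X Y : finType).
Variables (toX : {action gT &-> X}) (toY : {action fT &-> Y}).
Local Notation rX := (perm_rep C toX).
Local Notation rY := (perm_rep C toY).
Local Notation rXY := (perm_rep C (wr_action toX toY)).
Local Notation LXY := (funsp C (X * Y)).

Lemma eq_rows (s s' : LXY) : (forall x, row_at x s = row_at x s') -> s = s'.
Proof. by move=> ss'; apply/ffunP=> -[x y]; rewrite -!row_atE ss'. Qed.

Lemma eq_cols (s s' : LXY) : (forall y, col_at y s = col_at y s') -> s = s'.
Proof. by move=> ss'; apply/ffunP=> -[x y]; rewrite -!col_atE ss'. Qed.

Lemma map_rows_wr_rep W psi w (s : LXY) :
    intertwines [set: fT] rY rY W psi -> (forall x, row_at x s \in W) ->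
  map_rows X psi (rXY w s) = rXY w (map_rows X psi s).
Proof.
move=> eqv Ws; apply: eq_rows => x.
by rewrite row_map_rows !row_wr_rep row_map_rows eqv ?inE.
Qed.

Lemma map_cols_diag_pair (D : {set gT}) V phi u g (s : LXY) :
    intertwines D rX rX V phi -> g \in D -> (forall y, col_at y s \in V) ->
  map_cols Y phi (rXY (diag_pair toX u g) s) =
    rXY (diag_pair toX u g) (map_cols Y phi s).
Proof.
move=> eqv Dg Vs; apply: eq_cols => y.
by rewrite col_map_cols !col_diag_pair col_map_cols eqv.
Qed.

Lemma map_cols_sub V V' W phi (s : LXY) :
  (phi @: V <= V')%VS -> s \in tensv V W -> map_cols Y phi s \in tensv V' W.
Proof.
move=> sub VWs; rewrite memv_preim; apply: (subvP _ _ VWs); apply/tensvP=> f h Vf Wh.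
rewrite -memv_preim map_cols_tensf mem_tensf //.
by apply: (subvP sub); apply: memv_img.
Qed.

Lemma map_rows_sub V W W' psi (s : LXY) :
  (psi @: W <= W')%VS -> s \in tensv V W -> map_rows X psi s \in tensv V W'.
Proof.
move=> sub VWs; rewrite memv_preim; apply: (subvP _ _ VWs); apply/tensvP=> f h Vf Wh.
rewrite -memv_preim map_rows_tensf mem_tensf //.
by apply: (subvP sub); apply: memv_img.
Qed.

(** Between irreducible spaces it is enough to have a non-zero intertwiner, here
    phi (x) psi.  As 1 (x) psi works on rows it commutes with the whole wreath
    product, so only phi (x) 1 needs a hypothesis. *)
Lemma tensor_equivalent (E : {set wreath fT toX}) V V' W W' phi psi v w :
    irreducible E rXY (tensv V W) -> irreducible E rXY (tensv V' W') ->
    (phi @: V <= V')%VS -> (psi @: W <= W')%VS ->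
    intertwines [set: fT] rY rY W psi ->
    intertwines E rXY rXY (tensv V W) (map_cols Y phi) ->
    v \in V -> w \in W -> phi v != 0 -> psi w != 0 ->
  equivalent E rXY (tensv V W) (tensv V' W').
Proof.
move=> irrVW irrVW' subphi subpsi eqpsi eqphi Vv Ww phiv psiw.
pose chi := (map_rows X psi \o map_cols Y phi)%VF.
have chiE s : chi s = map_rows X psi (map_cols Y phi s) by rewrite comp_lfunE.
have eqchi : intertwines E rXY rXY (tensv V W) chi.
  move=> e s Ee VWs; rewrite !chiE eqphi //; apply: map_rows_wr_rep eqpsi _.
  by case/tensv_slicesP: (map_cols_sub subphi VWs).
have subchi : (chi @: tensv V W <= tensv V' W')%VS.
  apply/subvP=> _ /memv_imgP[s VWs ->]; rewrite chiE.
  exact: map_rows_sub subpsi (map_cols_sub subphi VWs).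
have chivw : chi (tensf v w) != 0.
  by rewrite chiE map_cols_tensf map_rows_tensf tensf_eq0 negb_or phiv.
have [im ker0] := schur irrVW irrVW' eqchi subchi (mem_tensf Vv Ww) chivw.
by exists chi.
Qed.

End MapSlices.

(** * Representations induced from the stabilizer of a part *)

Section SeqSums.
Variables (F : fieldType) (vT : vectType F) (I : eqType).
Implicit Types (s : seq I) (E : I -> {vspace vT}).

Lemma subv_sum_seqP s E (V : {vspace vT}) :
  {in s, forall i, (E i <= V)%VS} -> (\sum_(i <- s) E i <= V)%VS.
Proof.
move=> sub; rewrite big_seq; elim/big_rec: _ => [|i W si subW]; first exact: sub0v.
by rewrite subv_add sub.
Qed.

Lemma sumv_seq_sup s E i : i \in s -> (E i <= \sum_(j <- s) E j)%VS.
Proof. by move=> si; rewrite (big_rem i) //= addvSl. Qed.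

End SeqSums.

Section Restriction.
Variables (C : numClosedFieldType) (X : finType).
Local Notation LX := (funsp C X).

Definition restrf (A : {set X}) (f : LX) : LX :=
  [ffun x => if x \in A then f x else 0].

Fact restrf_is_linear A : linear (restrf A).
Proof.
move=> k f f'; apply/ffunP=> x; rewrite !ffunE.
by case: ifP => _; rewrite ?scaler0 ?addr0.
Qed.
HB.instance Definition _ A :=
  GRing.isLinear.Build C LX LX _ (restrf A) (restrf_is_linear A).

Definition restr A : 'End(LX) := linfun (restrf A).

Lemma restrE A f x : restr A f x = if x \in A then f x else 0.
Proof. by rewrite lfunE ffunE. Qed.

Lemma restr_supported A f : restr A f \in supported_on C A.
Proof. by apply/supported_onP=> x /negPf xA; rewrite restrE xA. Qed.

Lemma restr_id A f : f \in supported_on C A -> restr A f = f.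
Proof.
move=> /supported_onP f0; apply/ffunP=> x; rewrite restrE.
by case: ifPn => // /f0.
Qed.

Lemma eq_restr (A : {set X}) (f f' : LX) : {in A, f =1 f'} -> restr A f = restr A f'.
Proof. by move=> ff'; apply/ffunP=> x; rewrite !restrE; case: ifP => // /ff'. Qed.

Lemma dim_supported_on (A : {set X}) : (\dim (supported_on C A) <= #|A|)%N.
Proof.
have sub : (supported_on C A <= \sum_(x in A) <[delta C x]>)%VS.
  apply/subvP=> f /supported_onP f0; rewrite (sum_delta f).
  apply: memv_suml => x _; have [Ax|/f0->] := boolP (x \in A).
    by apply: memvZ; rewrite memvE (sumv_sup x).
  by rewrite scale0r mem0v.
apply: leq_trans (dimvS sub) _; apply: leq_trans (dimv_leq_sum _ _ _) _.
by rewrite -sum1_card; apply: leq_sum => x _; rewrite dim_vline leq_b1.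
Qed.

End Restriction.

Arguments restr {C X} A.

Lemma dim_funsp (C : numClosedFieldType) (Z : finType) :
  \dim {:funsp C Z} = #|Z|.
Proof. by rewrite dimvf /dim /= muln1. Qed.

Section Parts.
Variables (gT : finGroupType) (X : finType) (toX : {action gT &-> X}).
Variable P : {set {set X}}.
Hypotheses (partP : partition P [set: X]) (invP : [acts [set: gT], on P | toX^*]).

Lemma mem_part A x : A \in P -> (x \in A) = (pblock P x == A).
Proof.
have [/and3P[/eqP covP tiP _]] := partP => PA.
apply/idP/eqP => [|<-]; first exact: def_pblock.
by rewrite mem_pblock covP inE.
Qed.

Lemma pblock_in x : pblock P x \in P.
Proof. by rewrite pblock_mem // (cover_partition partP) inE. Qed.

Lemma lact_part g A : A \in P -> lact toX^*%act g A \in P.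
Proof. by rewrite /lact (acts_act invP) ?inE. Qed.

Lemma mem_lact g (A : {set X}) x : (lact toX g x \in lact toX^*%act g A) = (x \in A).
Proof. by exact: (mem_imset _ _ (act_inj toX g^-1%g)). Qed.

Lemma mem_lactV g (A : {set X}) x :
  (lact toX g^-1%g x \in A) = (x \in lact toX^*%act g A).
Proof. by rewrite -(mem_lact g) -lactM mulgV lact1. Qed.

End Parts.

Section Induced.
Variables (C : numClosedFieldType) (gT : finGroupType) (X : finType).
Variables (toX : {action gT &-> X}) (P : {set {set X}}).
Variables (A0 : {set X}) (T : {group gT}).
Hypotheses (trX : [transitive [set: gT], on [set: X] | toX]).
Hypotheses (partP : partition P [set: X]) (invP : [acts [set: gT], on P | toX^*]).
Hypotheses (A0P : A0 \in P) (defT : T :=: 'N(A0 | toX)%g).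
Local Notation LX := (funsp C X).
Local Notation rX := (perm_rep C toX).

Lemma mem_stab g : (g \in T) = (lact toX^*%act g A0 == A0).
Proof. by rewrite -groupV defT -astab1_set; apply/astab1P/eqP. Qed.

(** The translates of A0 are parts, so one that meets A0 is A0. *)
Lemma part_stab g x : x \in A0 -> (lact toX g x \in A0) = (g \in T).
Proof.
move=> A0x; rewrite mem_stab; apply/idP/eqP => [A0gx | <-]; last by rewrite mem_lact.
have gA0P := lact_part invP g A0P.
have : lact toX g x \in lact toX^*%act g A0 by rewrite mem_lact.
by rewrite (mem_part partP) // => /eqP <-; apply/eqP; rewrite -(mem_part partP).
Qed.

Lemma restr_perm_rep g A f :
  restr (lact toX^*%act g A) (rX g f) = rX g (restr A f).
Proof.
by apply/ffunP=> x; rewrite perm_repE !restrE mem_lactV perm_repE.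
Qed.

Lemma part_translate A : A \in P -> exists g, A = lact toX^*%act g A0.
Proof.
move=> PA; have [/and3P[_ tiP P0]] := partP.
have nonempty B : B \in P -> exists x, x \in B.
  by move=> PB; apply/set0Pn; apply: contraNneq P0 => <-.
have [[x Ax] [x0 A0x0]] := (nonempty A PA, nonempty A0 A0P).
have [g _ gx] := atransP2 trX (in_setT x0) (in_setT x).
exists g^-1%g; have gA0P := lact_part invP g^-1%g A0P.
have := Ax; rewrite (mem_part partP) // => /eqP <-; apply/eqP.
by rewrite -(mem_part partP) // gx /lact invgK; apply: mem_setact.
Qed.

Lemma sum_restr (f : LX) : f = \sum_(A in P) restr A f.
Proof.
apply/ffunP=> x; rewrite sum_ffunE (bigD1 (pblock P x)) ?(pblock_in partP) //=.
rewrite restrE (mem_part partP) ?(pblock_in partP) // eqxx big1 ?addr0 //.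
by move=> A /andP[PA neq]; rewrite restrE (mem_part partP) // eq_sym (negPf neq).
Qed.

Section InducedSpace.
Variable U : {vspace LX}.
Hypotheses (subU : (U <= supported_on C A0)%VS) (stU : stable T rX U).

Lemma perm_rep_sub_induced g : (rX g @: U <= induced toX T U)%VS.
Proof.
have gT_coset : (g *: T)%g \in lcosets T [set: gT].
  by apply/lcosetsP; exists g; rewrite ?inE.
apply: subv_trans (sumv_sup _ gT_coset (subvv _)).
have /lcosetP[t Tt ->] := mem_repr g (lcoset_refl T g).
apply/subvP=> _ /memv_imgP[u Uu ->].
have -> : rX g u = rX (g * t)%g (rX t^-1%g u) by rewrite -perm_repM mulgK.
by apply: memv_img; move/stableP: stU; apply; rewrite ?groupV.
Qed.

(** The summand l U of the induced space is what lives on the part l A0, so f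
    belongs to the induced space if and only if each of its restrictions to a
    part, moved to A0, belongs to U. *)
Lemma inducedP f :
  reflect (forall g, restr A0 (rX g f) \in U) (f \in induced toX T U).
Proof.
apply: (iffP idP) => [indf g | Uf].
  rewrite -comp_lfunE memv_preim; apply: (subvP _ _ indf).
  apply/subv_sumP=> c _; apply/subvP=> _ /memv_imgP[u Uu ->].
  rewrite -memv_preim comp_lfunE -perm_repM; move: (_ * _)%g => h.
  have [Th|nTh] := boolP (h \in T).
    have Uhu : rX h u \in U by move/stableP: stU; apply.
    by rewrite restr_id // (subvP subU).
  suff -> : restr A0 (rX h u) = 0 by exact: mem0v.
  apply/ffunP=> x; rewrite restrE ffunE; case: ifP => // A0x.
  rewrite perm_repE; have /supported_onP := subvP subU _ Uu; apply.
  by rewrite part_stab // groupV.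
rewrite (sum_restr f); apply: memv_suml => A /part_translate[g ->].
apply: (subvP (perm_rep_sub_induced g)).
have -> : restr (lact toX^*%act g A0) f = rX g (restr A0 (rX g^-1%g f)).
  by rewrite -restr_perm_rep -perm_repM mulgV perm_rep1.
exact: memv_img.
Qed.

Lemma sub_induced : (U <= induced toX T U)%VS.
Proof.
apply/subvP=> u Uu; rewrite -[u](perm_rep1 toX).
by rewrite (subvP (perm_rep_sub_induced 1%g)) // memv_img.
Qed.

Lemma induced_supported f :
  f \in induced toX T U -> f \in supported_on C A0 -> f \in U.
Proof. by move=> /inducedP/(_ 1%g); rewrite perm_rep1 => Uf /restr_id <-. Qed.

Lemma induced_perm_rep g f :
  f \in induced toX T U -> rX g f \in induced toX T U.
Proof. by move/inducedP=> Uf; apply/inducedP=> h; rewrite -perm_repM. Qed.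

(** Membership in the induced space is tested on one part at a time, so
    functions of that space on different parts can be glued. *)
Lemma induced_patch (f : LX) :
    (forall A, A \in P -> exists2 f', f' \in induced toX T U & {in A, f =1 f'}) ->
  f \in induced toX T U.
Proof.
move=> patch; apply/inducedP=> g.
have [f' /inducedP indf' ff'] := patch _ (lact_part invP g^-1%g A0P).
rewrite (_ : restr A0 (rX g f) = restr A0 (rX g f')) //.
apply: eq_restr => x A0x; rewrite !perm_repE; apply: ff'.
by rewrite mem_lact.
Qed.

End InducedSpace.

Section InducedMap.
Variable phi : 'End(LX).

(** The sum over all of G, instead of over representatives of the cosets of T,
    commutes with G for formal reasons.  The price is a factor #|T|: if phi maps
    U into L(A0) and commutes with T on U, the sum is #|T| phi on U. *)
Definition induced_map : 'End(LX) :=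
  \sum_g (rX g \o restr A0 \o phi \o restr A0 \o rX g^-1%g)%VF.

Lemma induced_mapE f :
  induced_map f = \sum_g rX g (restr A0 (phi (restr A0 (rX g^-1%g f)))).
Proof. by rewrite sum_lfunE; apply: eq_bigr => g _; rewrite !comp_lfunE. Qed.

Lemma induced_map_perm_rep h f : induced_map (rX h f) = rX h (induced_map f).
Proof.
rewrite !induced_mapE linear_sum (reindex_inj (mulgI h)) /=.
by apply: eq_bigr => g _; rewrite -!perm_repM invMg mulgKV.
Qed.

(** The term at g only uses the values on g A0, and lives on g A0. *)
Lemma induced_map_local A (f f' : LX) : A \in P ->
  {in A, f =1 f'} -> {in A, induced_map f =1 induced_map f'}.
Proof.
move=> PA ff' x Ax; rewrite !induced_mapE !sum_ffunE; apply: eq_bigr => g _.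
rewrite !perm_repE !restrE; case: ifP => // A0gx.
congr (phi _ _); apply: eq_restr => x' A0x'; rewrite !perm_repE invgK; apply: ff'.
have gA0P := lact_part invP g A0P.
move: Ax; rewrite (mem_part partP) // => /eqP <-.
have : x \in lact toX^*%act g A0 by rewrite -mem_lactV.
by rewrite (mem_part partP) // => /eqP->; rewrite mem_lact.
Qed.

Lemma induced_map_sub (U U' : {vspace LX}) :
    (U <= supported_on C A0)%VS -> stable T rX U ->
    (U' <= supported_on C A0)%VS -> stable T rX U' -> (phi @: U <= U')%VS ->
  forall f, f \in induced toX T U -> induced_map f \in induced toX T U'.
Proof.
move=> subU stU subU' stU' sub f /(inducedP subU stU) Uf.
rewrite induced_mapE; apply: memv_suml => g _.
apply: (subvP (perm_rep_sub_induced stU' g)); apply: memv_img.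
have U'v : phi (restr A0 (rX g^-1%g f)) \in U'.
  by apply: (subvP sub); apply: memv_img.
by rewrite restr_id // (subvP subU').
Qed.

Lemma induced_map_neq0 (U U' : {vspace LX}) u :
    (U <= supported_on C A0)%VS -> stable T rX U ->
    (U' <= supported_on C A0)%VS -> (phi @: U <= U')%VS ->
    intertwines T rX rX U phi -> u \in U -> phi u != 0 ->
  induced_map u != 0.
Proof.
move=> subU /stableP stU subU' sub eqv Uu /ffun_neq0P[x phiux].
have phi_supp v : v \in U -> phi v \in supported_on C A0.
  by move=> Uv; apply: (subvP subU'); apply: (subvP sub); apply: memv_img.
have A0x : x \in A0.
  by apply: contraNT phiux => nA0x; have /supported_onP-> := phi_supp u Uu.
apply/ffun_neq0P; exists x.
rewrite induced_mapE sum_ffunE (bigID (mem T)) /= addrC big1 ?add0r; last first.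
  by move=> g nTg; rewrite perm_repE restrE part_stab // groupV (negPf nTg).
rewrite (eq_bigr (fun=> phi u x)) => [|g Tg].
  by rewrite sumr_const -mulr_natr mulf_neq0 // pnatr_eq0 -lt0n cardG_gt0.
have Ugu : rX g^-1%g u \in U by rewrite stU ?groupV.
rewrite (restr_id (subvP subU _ Ugu)) (restr_id (phi_supp _ Ugu)).
by rewrite -eqv // -perm_repM mulgV perm_rep1.
Qed.

End InducedMap.

(** A point of A0 has the same stabilizer in T and in G, and its orbits are A0
    and X, so that #|G : T| = #|X| / #|A0|. *)
Lemma dim_induced (U : {vspace LX}) :
  (\dim (induced toX T U) * #|A0| <= #|X| * \dim U)%N.
Proof.
have [/and3P[_ _ P0]] := partP.
have /set0Pn[x0 A0x0] : A0 != set0 by apply: contraNneq P0 => <-.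
have card_A0 : orbit toX T x0 = A0.
  apply/setP=> x; apply/orbitP/idP => [[t Tt <-]|A0x].
    by rewrite -[t]invgK part_stab // groupV.
  have [g _ gx] := atransP2 trX (in_setT x0) (in_setT x).
  exists g => //; rewrite -groupV -(part_stab _ A0x0).
  by rewrite /lact invgK -gx.
have stabT : 'C_T[x0 | toX]%g = 'C_[set: gT][x0 | toX]%g.
  apply/setP=> g; rewrite !in_setI in_setT /=; apply: andb_idl.
  rewrite inE sub1set inE => /eqP gx; rewrite -groupV -(part_stab _ A0x0).
  by rewrite /lact invgK gx.
have cardX := card_orbit_stab toX [set: gT]%G x0.
have cardA0 := card_orbit_stab toX T x0.
have index_A0 : (#|lcosets T [set: gT]| * #|A0| = #|X|)%N.
  rewrite card_A0 stabT in cardA0; rewrite (atransP trX) ?inE // cardsT in cardX.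
  have stab_gt0 : (0 < #|'C_[set: gT][x0 | toX]%g|)%N by exact: cardG_gt0.
  apply/eqP; rewrite -(eqn_pmul2r stab_gt0) -mulnA cardA0 cardX.
  by rewrite card_lcosets mulnC Lagrange ?subsetT.
rewrite -index_A0 mulnAC leq_pmul2r; last first.
  by rewrite card_gt0; apply/set0Pn; exists x0.
apply: leq_trans (dimv_leq_sum _ _ _) _; rewrite -sum_nat_const.
apply: leq_sum => c _.
by rewrite -(limg_ker_dim (rX (repr c)) U) leq_addl.
Qed.

Section InducedSum.
Variables (I : finType) (U : I -> seq {vspace LX}).

Lemma induced_span :
    (forall i u, u \in U i -> stable T rX u) ->
    supported_on C A0 = (\sum_i \sum_(u <- U i) u)%VS ->
  fullv = (\sum_i \sum_(u <- U i) induced toX T u)%VS.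
Proof.
move=> stU sumU; apply/eqP; rewrite eqEsubv subvf andbT; apply/subvP=> f _.
rewrite (sum_restr f); apply: memv_suml => A /part_translate[g ->].
have -> : f = rX g (rX g^-1%g f) by rewrite -perm_repM mulgV perm_rep1.
rewrite restr_perm_rep memv_preim; have := restr_supported A0 (rX g^-1%g f).
rewrite sumU; apply: subvP; apply/subv_sumP=> i _.
apply: subv_sum_seqP => u Uu; apply/subvP=> v uv; rewrite -memv_preim.
apply: (subvP _ _ (subvP (perm_rep_sub_induced (stU i u Uu) g) _ (memv_img _ uv))).
by apply: (sumv_sup i) => //; apply: (sumv_seq_sup (induced toX T)).
Qed.

Lemma sum_dim_induced :
    \dim (supported_on C A0) = (\sum_i \sum_(u <- U i) \dim u)%N ->
  (\sum_i \sum_(u <- U i) \dim (induced toX T u) <= #|X|)%N.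
Proof.
move=> dimU; have [/and3P[_ _ P0]] := partP.
have A0_gt0 : (0 < #|A0|)%N by rewrite card_gt0; apply: contraNneq P0 => <-.
rewrite -(leq_pmul2r A0_gt0).
apply: leq_trans (_ : #|X| * \dim (supported_on C A0) <= _)%N; last first.
  by rewrite leq_mul2l dim_supported_on orbT.
rewrite dimU big_distrl big_distrr; apply: leq_sum => i _ /=.
rewrite big_distrl big_distrr; apply: leq_sum => u _ /=.
exact: dim_induced.
Qed.

End InducedSum.

End Induced.

(** * The crested product *)

Section Crested.
Variables (C : numClosedFieldType) (fT gT : finGroupType) (Y X : finType).
Variables (toY : {action fT &-> Y}) (toX : {action gT &-> X}).
Variables (P : {set {set X}}) (Q : {set {set Y}}) (N : {group fT}).
Variables (A0 : {set X}) (T : {group gT}).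
Hypotheses (trX : [transitive [set: gT], on [set: X] | toX]).
Hypotheses (partP : partition P [set: X]).
Hypotheses (invP : [acts [set: gT], on P | toX^*]).
Hypotheses (partQ : partition Q [set: Y]).
Hypotheses (invQ : [acts [set: fT], on Q | toY^*]).
Hypotheses (defN : N :=: 'C(Q | toY^*)%g).
Hypotheses (trN : {in Q, forall B : {set Y}, [transitive N, on B | toY]}).
Hypotheses (A0P : A0 \in P) (defT : T :=: 'N(A0 | toX)%g).
Local Notation LX := (funsp C X).
Local Notation LY := (funsp C Y).
Local Notation LXY := (funsp C (X * Y)).
Local Notation rX := (perm_rep C toX).
Local Notation rY := (perm_rep C toY).
Local Notation rXY := (perm_rep C (wr_action toX toY)).
Local Notation LQ := (constant_on_parts C Q).
Local Notation E := (crested toX N P).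
Local Notation diag := (diag_pair toX).

(** The orbits of N on Y are the parts of Q. *)
Lemma fixed_constant_on_parts (h : LY) :
  {in N, forall n, rY n h = h} <-> h \in LQ.
Proof.
split=> [fixh | /constant_on_partsP hQ n Nn].
  apply/constant_on_partsP=> B y y' QB By By'.
  have [n Nn ->] := atransP2 (trN QB) By By'.
  by rewrite -{1}(fixh n Nn) perm_repE /lact invgK.
apply/ffunP=> y; rewrite perm_repE; apply: (hQ (pblock Q y)).
- exact: pblock_in.
- have <- : lact toY^*%act n^-1%g (pblock Q y) = pblock Q y.
    move: Nn; rewrite defN => /astabP fixQ.
    by rewrite /lact invgK fixQ // pblock_in.
  by rewrite mem_lact mem_pblock (cover_partition partQ) inE.
- by rewrite mem_pblock (cover_partition partQ) inE.
Qed.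

Lemma constant_on_parts_stable : stable [set: fT] rY LQ.
Proof.
apply/stableP=> u h _ /constant_on_partsP hQ.
apply/constant_on_partsP=> B y y' QB By By'.
rewrite !perm_repE; apply: (hQ (lact toY^*%act u^-1%g B)); rewrite ?mem_lact //.
exact: lact_part.
Qed.

Lemma crestedP w :
  reflect (exists h u, [/\ forall x, h x \in N,
             forall A x x', A \in P -> x \in A -> x' \in A -> h x = h x' :> fT
           & forall x, wr_base w x = h x * u]%g)
    (w \in E).
Proof. by rewrite inE; apply: crested_baseP. Qed.

Lemma diag_crested u g : diag u g \in E.
Proof.
apply/crestedP; exists (fun=> 1%g), u; split=> // x; rewrite ?group1 //.
by rewrite ffunE mul1g.
Qed.

(** The element n of N acting over A, and the identity over the other parts. *)
Definition part_elt (A : {set X}) (n : fT) : wreath fT toX :=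
  Wreath toX [ffun x => if x \in A then n else 1%g] 1%g.

Lemma part_elt_crested A n : A \in P -> n \in N -> part_elt A n \in E.
Proof.
move=> PA Nn; apply/crestedP; exists (fun x => if x \in A then n else 1%g), 1%g.
split=> [x|B x x' PB Bx Bx'|x]; first by case: ifP.
  by move: Bx Bx'; rewrite !(mem_part partP) // => /eqP-> /eqP->.
by rewrite ffunE mulg1.
Qed.

Lemma row_part_elt A n (s : LXY) x :
  row_at x (rXY (part_elt A n) s) =
    if x \in A then rY n (row_at x s) else row_at x s.
Proof.
by rewrite row_wr_rep ffunE /= invg1 lact1; case: ifP => // _; rewrite perm_rep1.
Qed.

(** The factor in N of the base component acts trivially on L(Q). *)
Lemma crested_acts_diagonally w : w \in E ->
  exists u, forall s, (forall x, row_at x s \in LQ) ->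
    rXY w s = rXY (diag u (wr_top w)) s.
Proof.
move=> /crestedP[h [u [hN _ wE]]]; exists u => s LQs; apply: eq_rows => x.
rewrite row_diag_pair row_wr_rep wE perm_repM.
have /fixed_constant_on_parts -> // :
    rY u (row_at (lact toX (wr_top w)^-1%g x) s) \in LQ.
by move/stableP: constant_on_parts_stable; apply; rewrite ?inE.
Qed.

(** The base component of an element of the crested product is constant on each
    part of P. *)
Lemma crested_acts_locally_diagonally w A : w \in E -> A \in P ->
  exists u, forall s x, x \in A ->
    row_at x (rXY w s) = row_at x (rXY (diag u (wr_top w)) s).
Proof.
move=> /crestedP[h [u [_ hP wE]]] PA.
have [->|/set0Pn[x0 Ax0]] := eqVneq A set0; first by exists 1%g => s x; rewrite inE.
exists (wr_base w x0) => s x Ax.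
by rewrite row_diag_pair row_wr_rep !wE (hP A x x0).
Qed.

Section ConstantFactor.
Variables (V : {vspace LX}) (W : {vspace LY}).
Hypotheses (irrV : irreducible [set: gT] rX V) (irrW : irreducible [set: fT] rY W).
Hypothesis (subW : (W <= LQ)%VS).

Lemma tensv_rows_LQ (s : LXY) : s \in tensv V W -> forall x, row_at x s \in LQ.
Proof. by case/tensv_slicesP=> rows _ x; apply: (subvP subW). Qed.

Lemma tensv_crested_irreducible : irreducible E rXY (tensv V W).
Proof.
split; first by apply: tensv_neq0; [case: irrV | case: irrW].
  apply/stableP=> w s Ew VWs; have [u wE] := crested_acts_diagonally Ew.
  rewrite wE; last exact: tensv_rows_LQ.
  by apply: (tensv_diag_stable (D := [set: gT]%G) irrV irrW); rewrite ?inE.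
move=> S /stableP stS; apply: (tensv_diag_irreducible (D := [set: gT]%G) irrV irrW).
by move=> u g s _; apply: stS; apply: diag_crested.
Qed.

End ConstantFactor.

Lemma tensv_crested_equivalent V V' W W' :
    irreducible [set: gT] rX V -> irreducible [set: gT] rX V' ->
    irreducible [set: fT] rY W -> irreducible [set: fT] rY W' ->
    (W <= LQ)%VS -> (W' <= LQ)%VS ->
    equivalent [set: gT] rX V V' -> equivalent [set: fT] rY W W' ->
  equivalent E rXY (tensv V W) (tensv V' W').
Proof.
move=> irrV irrV' irrW irrW' subW subW' [phi [imV kerV eqV]] [psi [imW kerW eqW]].
have [[V0 _ _] [W0 _ _]] := (irrV, irrW).
have subV' : (phi @: V <= V')%VS by rewrite imV.
apply: (tensor_equivalent (phi := phi) (psi := psi) (v := vpick V) (w := vpick W));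
  rewrite ?memv_pick ?imW //; try exact: tensv_crested_irreducible;
  try by rewrite (equivalent_neq0 _ (memv_pick _)) ?vpick0.
move=> e s Ee VWs; have [u eE] := crested_acts_diagonally Ee.
rewrite !eE; last first.
- exact: tensv_rows_LQ subW _ VWs.
- exact: tensv_rows_LQ subW _ (map_cols_sub subV' VWs).
case/tensv_slicesP: VWs => _ cols.
by apply: map_cols_diag_pair eqV _ cols; rewrite inE.
Qed.

Lemma tensv_crested_factors V V' W W' :
    irreducible [set: gT] rX V -> irreducible [set: gT] rX V' ->
    irreducible [set: fT] rY W -> irreducible [set: fT] rY W' ->
    equivalent E rXY (tensv V W) (tensv V' W') ->
  equivalent [set: gT] rX V V' /\ equivalent [set: fT] rY W W'.
Proof.
move=> irrV irrV' irrW irrW' [phi [im ker0 eqv]].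
apply: (tensor_intertwiner (D := [set: gT]%G) irrV irrW irrV' irrW' (phi := phi)).
- by move=> u g s _; apply: eqv; apply: diag_crested.
- by rewrite im.
apply/negP=> /capv_idPl; rewrite ker0 => /esym/eqP; apply/negP.
by apply: tensv_neq0; [case: irrV | case: irrW].
Qed.

(** As L(Q) is the space of N-invariants, this says that 0 is the only
    N-invariant vector in W. *)
Definition invariant_free (W : {vspace LY}) := (W :&: LQ = 0)%VS.

Lemma invariant_free_fixed W (h : LY) :
  invariant_free W -> h \in W -> {in N, forall n, rY n h = h} -> h = 0.
Proof.
move=> freeW Wh /fixed_constant_on_parts LQh.
by apply/eqP; rewrite -memv0 -freeW memv_cap Wh.
Qed.

Lemma invariant_free_fixed_rows V W (s : LXY) :
    invariant_free W -> s \in tensv V W ->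
    (forall n, n \in N -> rXY (diag n 1) s = s) ->
  s = 0.
Proof.
move=> freeW /tensv_slicesP[rows _] fixs; apply: eq_rows => x.
rewrite linear0; apply: (invariant_free_fixed freeW) => // n Nn.
by rewrite -[in RHS](fixs n Nn) row_diag_pair invg1 lact1.
Qed.

(** The constant functions with value in N fix every vector of V (x) W and no
    non-zero vector of V' (x) W'.  An equivalence respects this. *)
Lemma constant_free_inequivalent V V' W W' :
    V != 0%VS -> W != 0%VS -> (W <= LQ)%VS -> invariant_free W' ->
  ~ equivalent E rXY (tensv V W) (tensv V' W').
Proof.
move=> V0 W0 subW freeW' [phi [im ker0 eqv]].
have VWs := memv_pick (tensv V W); set s := vpick _ in VWs.
have s0 : s != 0 by rewrite vpick0 tensv_neq0.
have := equivalent_neq0 ker0 VWs s0.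
rewrite (invariant_free_fixed_rows (V := V') (s := phi s) freeW') ?eqxx //.
  by rewrite -im memv_img.
move=> n Nn; rewrite -eqv ?diag_crested //; congr (phi _).
apply: eq_rows => x; rewrite row_diag_pair invg1 lact1.
by have /fixed_constant_on_parts -> := tensv_rows_LQ subW VWs x.
Qed.

Lemma free_constant_inequivalent V V' W W' :
    V != 0%VS -> W != 0%VS -> stable E rXY (tensv V W) ->
    invariant_free W -> (W' <= LQ)%VS ->
  ~ equivalent E rXY (tensv V W) (tensv V' W').
Proof.
move=> V0 W0 stVW freeW subW' [phi [im ker0 eqv]].
have VWs := memv_pick (tensv V W); set s := vpick _ in VWs.
have s0 : s != 0 by rewrite vpick0 tensv_neq0.
case/eqP: s0; apply: (invariant_free_fixed_rows freeW VWs) => n Nn.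
have VWes : rXY (diag n 1) s \in tensv V W.
  by move/stableP: stVW; apply; rewrite ?diag_crested.
apply/eqP; rewrite -subr_eq0 -memv0 -ker0 memv_cap memvB // memv_ker linearB /=.
rewrite eqv ?diag_crested // subr_eq0; apply/eqP; apply: eq_rows => x.
rewrite row_diag_pair invg1 lact1.
have V'W'phis : phi s \in tensv V' W' by rewrite -im memv_img.
by have /fixed_constant_on_parts -> := tensv_rows_LQ subW' V'W'phis x.
Qed.

Section FreeFactor.
Variables (U : {vspace LX}) (W : {vspace LY}).
Hypotheses (irrU : irreducible T rX U) (irrW : irreducible [set: fT] rY W).
Hypotheses (subU : (U <= supported_on C A0)%VS) (freeW : invariant_free W).

Let stU : stable T rX U. Proof. by case: irrU. Qed.
Local Notation indU := (induced toX T U).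

Lemma sub_tensv_induced : (tensv U W <= tensv indU W)%VS.
Proof.
apply/tensvP=> f h Uf; apply: mem_tensf.
exact: (subvP (sub_induced stU)).
Qed.

Lemma tensv_induced_stable : stable E rXY (tensv indU W).
Proof.
have [_ /stableP stW _] := irrW.
apply/stableP=> w s Ew /tensv_slicesP[rows cols]; apply/tensv_slicesP; split=> [x|y].
  by rewrite row_wr_rep stW ?inE.
apply: (induced_patch trX partP invP A0P defT subU stU) => A PA.
have [u wE] := crested_acts_locally_diagonally Ew PA.
exists (col_at y (rXY (diag u (wr_top w)) s)).
  rewrite col_diag_pair.
  exact: (induced_perm_rep trX partP invP A0P defT subU stU).
by move=> x Ax; rewrite !col_atE -!row_atE wE.
Qed.

(** The columns of s are in Ind U and live on A0, hence are in U. *)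
Lemma induced_supported_tensv (s : LXY) :
    s \in tensv indU W -> (forall x, x \notin A0 -> row_at x s = 0) ->
  s \in tensv U W.
Proof.
move=> /tensv_slicesP[rows cols] s0; apply/tensv_slicesP; split=> // y.
apply: (induced_supported trX partP invP A0P defT subU stU (cols y)).
by apply/supported_onP=> x nA0x; rewrite col_atE -row_atE s0 // ffunE.
Qed.

(** For s in S with a non-zero row at x, some n in N moves that row.  The
    difference of s and its image under n acting over the part of x only lives
    over this part; translated to A0 it is a non-zero element of S in U (x) W.
    Then S contains U (x) W by irreducibility under T x F, and its translates
    span the whole space. *)
Lemma tensv_induced_irreducible : irreducible E rXY (tensv indU W).
Proof.
have [U0 _ _] := irrU; have [W0 _ _] := irrW.
split; last first.
- move=> S stS subS; have [->|S0] := eqVneq S 0%VS; [by left | right].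
  apply/eqP; rewrite eqEsubv subS.
  have Ss := memv_pick S; set s := vpick S in Ss.
  have s0 : s != 0 by rewrite vpick0.
  have [x row_s] := neq0_rowP s0.
  have /tensv_slicesP[rows_s _] := subvP subS _ Ss.
  have [n Nn moved] : exists2 n, n \in N & rY n (row_at x s) != row_at x s.
    apply/exists_inP; apply: contraR row_s; rewrite negb_exists_in.
    move=> /forall_inP fixed.
    apply/eqP; apply: (invariant_free_fixed freeW) => // n Nn.
    by apply/eqP; have := fixed n Nn; rewrite negbK.
  have PA := pblock_in partP x; set A := pblock P x in PA.
  have Ax : x \in A by rewrite (mem_part partP).
  move/stableP: (stS) => stS'.
  have [g gA] := part_translate trX partP invP A0P PA; rewrite -/A in gA.
  pose s1 := rXY (part_elt A n) s - s.
  have row_s1 x' : x' \notin A -> row_at x' s1 = 0.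
    by move=> nAx'; rewrite linearB /= row_part_elt (negPf nAx') subrr.
  have Ss1 : s1 \in S by rewrite memvB // stS' // part_elt_crested.
  pose s2 := rXY (diag 1 g^-1) s1.
  have Ss2 : s2 \in S by rewrite stS' // diag_crested.
  have s2_neq0 : s2 != 0.
    apply/neq0_rowP; exists (lact toX g^-1%g x).
    rewrite row_diag_pair perm_rep1 -lactM mulVg lact1.
    by rewrite linearB /= row_part_elt Ax subr_eq0.
  have UWs2 : s2 \in tensv U W.
    apply: induced_supported_tensv; first exact: (subvP subS).
    move=> x' nA0x'; rewrite row_diag_pair perm_rep1 invgK row_s1 //.
    by rewrite gA mem_lact.
  have subUW : (tensv U W <= S)%VS.
    apply: (tensor_irreducible irrU irrW _ Ss2 UWs2 s2_neq0).
    by move=> u h s' _ Ss'; rewrite stS' // diag_crested.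
  apply/tensvP=> f h indf Wh; rewrite -tens_lE memv_preim.
  apply: (subvP _ _ indf); apply/subv_sumP=> c _.
  apply/subvP=> _ /memv_imgP[v Uv ->].
  rewrite -memv_preim tens_lE -[h](perm_rep1 toY) -diag_pair_tensf.
  by rewrite stS' ?diag_crested // (subvP subUW) // mem_tensf.
- exact: tensv_induced_stable.
apply: tensv_neq0 => //; apply: contraNneq U0 => ind0.
by rewrite -subv0 -ind0; apply: sub_induced.
Qed.

End FreeFactor.

(** The induced map commutes with G and with restriction to parts.  Over each
    part an element of the crested product acts as some (g, u), so applying
    the induced map to all columns commutes with the crested product. *)
Lemma tensv_induced_equivalent U U' W W' :
    irreducible T rX U -> irreducible T rX U' ->
    irreducible [set: fT] rY W -> irreducible [set: fT] rY W' ->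
    (U <= supported_on C A0)%VS -> (U' <= supported_on C A0)%VS ->
    invariant_free W -> invariant_free W' ->
    equivalent T rX U U' -> equivalent [set: fT] rY W W' ->
  equivalent E rXY (tensv (induced toX T U) W) (tensv (induced toX T U') W').
Proof.
move=> irrU irrU' irrW irrW' subU subU' freeW freeW'.
move=> [phi [imU kerU eqU]] [psi [imW kerW eqW]].
have [[U0 stU _] [W0 _ _]] := (irrU, irrW); have [_ stU' _] := irrU'.
have phiU : (phi @: U <= U')%VS by rewrite imU.
have phiu : phi (vpick U) != 0.
  by apply: (equivalent_neq0 kerU); rewrite ?memv_pick ?vpick0.
have psiw : psi (vpick W) != 0.
  by apply: (equivalent_neq0 kerW); rewrite ?memv_pick ?vpick0.
have indu : vpick U \in induced toX T U.
  by apply: (subvP (sub_induced stU)); apply: memv_pick.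
have subind : (induced_map toX A0 phi @: induced toX T U <= induced toX T U')%VS.
  apply/subvP=> _ /memv_imgP[f indf ->].
  exact: (induced_map_sub trX partP invP A0P defT subU stU subU' stU' phiU).
have indphi0 := induced_map_neq0 partP invP A0P defT subU stU subU' phiU eqU
  (memv_pick U) phiu.
apply: (tensor_equivalent _ _ subind _ eqW _ indu (memv_pick W) indphi0 psiw).
- exact: tensv_induced_irreducible.
- exact: tensv_induced_irreducible.
- by rewrite imW.
move=> e s Ee _; apply/ffunP=> -[x y].
have PA := pblock_in partP x; set A := pblock P x in PA.
have Ax : x \in A by rewrite (mem_part partP).
have [u eE] := crested_acts_locally_diagonally Ee PA.
rewrite map_colsE -[RHS]row_atE eE // row_atE -[RHS]col_atE.
rewrite col_diag_pair col_map_cols.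
rewrite -induced_map_perm_rep -col_diag_pair /=.
apply: (induced_map_local partP invP A0P phi PA) => // x' Ax'.
by rewrite !col_atE -!row_atE eE.
Qed.

(** An element of U (x) W is fixed by the elements of N acting over a part other
    than A0, so its image has N-invariant rows there.  These rows vanish, and
    the image lies in U' (x) W'.  What remains is an intertwiner for T x F. *)
Lemma tensv_induced_factors U U' W W' :
    irreducible T rX U -> irreducible T rX U' ->
    irreducible [set: fT] rY W -> irreducible [set: fT] rY W' ->
    (U <= supported_on C A0)%VS -> (U' <= supported_on C A0)%VS ->
    invariant_free W' ->
    equivalent E rXY (tensv (induced toX T U) W) (tensv (induced toX T U') W') ->
  equivalent T rX U U' /\ equivalent [set: fT] rY W W'.
Proof.
move=> irrU irrU' irrW irrW' subU subU' freeW' [phi [im ker0 eqv]].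
have [[U0 stU _] [W0 _ _]] := (irrU, irrW).
have subUW := subvP (sub_tensv_induced W irrU).
apply: (tensor_intertwiner irrU irrW irrU' irrW' (phi := phi)).
- by move=> u g s _ UWs; apply: eqv; rewrite ?diag_crested // subUW.
- apply/subvP=> _ /memv_imgP[s UWs ->].
  have indphi : phi s \in tensv (induced toX T U') W'.
    by rewrite -im memv_img // subUW.
  apply: (induced_supported_tensv irrU' subU' indphi) => x nA0x.
  have PA := pblock_in partP x; set A := pblock P x in PA.
  have Ax : x \in A by rewrite (mem_part partP).
  apply: (invariant_free_fixed freeW') => [|n Nn].
    by case/tensv_slicesP: indphi.
  (* Over A <> A0, s vanishes. *)
  have : rXY (part_elt A n) (phi s) = phi s.
    rewrite -eqv ?part_elt_crested ?subUW //; congr (phi _); apply: eq_rows => x'.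
    rewrite row_part_elt; case: ifP => // Ax'.
    have -> : row_at x' s = 0; last by rewrite linear0.
    have nA0x' : x' \notin A0.
      apply: contra nA0x => A0x'; move: A0x' Ax'.
      by rewrite !(mem_part partP) // => /eqP-> /eqP->.
    have /tensv_slicesP[_ cols] := UWs.
    apply/ffunP=> y; rewrite row_atE -col_atE ffunE.
    by have /supported_onP-> := subvP subU _ (cols y).
  by move=> {2}<-; rewrite row_part_elt Ax.
apply/negP=> sub; have UW0 := tensv_neq0 U0 W0.
case/negP: UW0; rewrite -subv0 -ker0 subv_cap sub andbT.
exact/subvP.
Qed.

End Crested.

(** * Isotypic decompositions and dimensions *)

Section Isotypic.
Variables (F : fieldType) (vT : vectType F) (gT : finGroupType).
Variables (D : {set gT}) (r : gT -> 'End(vT)) (S : {vspace vT}).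
Variables (I : finType) (m : I -> nat) (W : I -> seq {vspace vT}).
Hypothesis decS : isotypic_decomposition D r S m W.

Lemma isotypic_dim : \dim S = (\sum_i \sum_(U <- W i) \dim U)%N.
Proof. by case: decS => _ _ _ /directvP dirW ->. Qed.

Lemma isotypic_sub i U : U \in W i -> (U <= S)%VS.
Proof.
move=> WU; case: decS => _ _ _ _ ->; apply: (sumv_sup i) => //.
exact: (sumv_seq_sup id).
Qed.

(** U lies in the isotypic component of index i, which is independent of the
    sum of the others. *)
Lemma isotypic_disjoint (J : {set I}) i U : i \notin J -> U \in W i ->
  (U :&: (\sum_(j in J) \sum_(U' <- W j) U') = 0)%VS.
Proof.
move=> nJi WU; case: decS => _ _ _ /directv_sumE[_ /directv_sumP dirW] _.
apply/eqP; rewrite -subv0 -[X in (_ <= X)%VS](dirW i) //; apply: capvS.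
  exact: (sumv_seq_sup id).
apply/subv_sumP=> j Jj; apply: (sumv_sup j) => //=.
by apply: contraNneq nJi => <-.
Qed.

End Isotypic.

Lemma dim_tensv (C : numClosedFieldType) (X Y : finType)
    (V : {vspace funsp C X}) (W : {vspace funsp C Y}) :
  (\dim (tensv V W) <= \dim V * \dim W)%N.
Proof. by apply: leq_trans (dim_span _) _; rewrite size_allpairs !size_tuple. Qed.

Lemma sum_dim_tensv (C : numClosedFieldType) (X Y I J : finType)
    (V : I -> seq {vspace funsp C X}) (W : J -> seq {vspace funsp C Y}) :
  (\sum_(p : I * J) \sum_(M <- [seq tensv v w | v <- V p.1, w <- W p.2]) \dim M
     <= (\sum_i \sum_(v <- V i) \dim v) * (\sum_j \sum_(w <- W j) \dim w))%N.
Proof.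
rewrite big_distrlr /= pair_bigA /=; apply: leq_sum => p _.
rewrite big_allpairs_dep big_distrlr /=.
by apply: leq_sum => v _; apply: leq_sum => w _; apply: dim_tensv.
Qed.

Lemma big_subtype (I : finType) (B : pred I) (F : I -> nat) :
  (\sum_(i : {i | B i}) F (val i) = \sum_(i | B i) F i)%N.
Proof. by rewrite (big_sub [pred i | B i]). Qed.

Lemma tensv_span (C : numClosedFieldType) (X Y : finType)
    (M : {vspace funsp C (X * Y)}) :
  (forall f h, tensf f h \in M) -> fullv = M.
Proof.
move=> Mfh; apply/eqP; rewrite eqEsubv subvf andbT.
have -> : fullv = tensv (C := C) (X := X) (Y := Y) fullv fullv.
  apply/esym/eqP; rewrite eqEsubv subvf; apply/subvP=> s _.
  by apply/tensv_slicesP; split=> ?; exact: memvf.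
by apply/tensvP=> f h _ _.
Qed.

Theorem theorem4p12 (C : numClosedFieldType)
    (fT gT : finGroupType) (Y X : finType)
    (toY : {action fT &-> Y}) (toX : {action gT &-> X})
    (y0 : Y) (x0 : X) (H : {group fT}) (K : {group gT})
    (trY : [transitive [set: fT], on [set: Y] | toY])
    (trX : [transitive [set: gT], on [set: X] | toX])
    (defH : H :=: 'C[y0 | toY]%g) (defK : K :=: 'C[x0 | toX]%g)
    (P : {set {set X}}) (Q : {set {set Y}})
    (partP : partition P [set: X]) (partQ : partition Q [set: Y])
    (invP : [acts [set: gT], on P | toX^*])
    (invQ : [acts [set: fT], on Q | toY^*])
    (N : {group fT}) (defN : N :=: 'C(Q | toY^*)%g)
    (trN : {in Q, forall B : {set Y}, [transitive N, on B | toY]})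
    (A0 : {set X}) (A0P : A0 \in P) (x0A0 : x0 \in A0)
    (T : {group gT}) (defT : T :=: 'N(A0 | toX)%g)
    (Omega Delta Gamma : finType)
    (a : Omega -> nat) (V : Omega -> seq {vspace funsp C X})
    (decX : isotypic_decomposition [set: gT] (perm_rep C toX) fullv a V)
    (b : Delta -> nat) (W : Delta -> seq {vspace funsp C Y})
    (decY : isotypic_decomposition [set: fT] (perm_rep C toY) fullv b W)
    (c : Gamma -> nat) (U : Gamma -> seq {vspace funsp C X})
    (decA0 : isotypic_decomposition T (perm_rep C toX)
               (supported_on C A0) c U)
    (Delta0 : {set Delta})
    (decQ : constant_on_parts C Q =
              (\sum_(d in Delta0) \sum_(w <- W d) w)%VS) :
  isotypic_decomposition
    (crested toX N P) (perm_rep C (wr_action toX toY)) fullv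
    (I := (Omega * {d : Delta | d \in Delta0}
           + Gamma * {d : Delta | d \notin Delta0})%type)
    (fun i => match i with
              | inl (o, d) => (a o * b (val d))%N
              | inr (g, d) => (c g * b (val d))%N
              end)
    (fun i => match i with
              | inl (o, d) => [seq tensv v w | v <- V o, w <- W (val d)]
              | inr (g, d) =>
                  [seq tensv (induced toX T u) w | u <- U g, w <- W (val d)]
              end).
Proof.
have [sizeV irrV eqV _ sumV] := decX.
have [sizeW irrW eqW _ sumW] := decY.
have [sizeU irrU eqU _ sumU] := decA0.
have subU g u : u \in U g -> (u <= supported_on C A0)%VS.
  exact: isotypic_sub decA0 _ _.
have stU g u : u \in U g -> stable T (perm_rep C toX) u.
  by case/irrU.
have constW d w : d \in Delta0 -> w \in W d -> (w <= constant_on_parts C Q)%VS.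
  move=> D0d Wd; rewrite decQ; apply: (sumv_sup d) => //.
  exact: (sumv_seq_sup id).
have freeW d w : d \notin Delta0 -> w \in W d -> invariant_free Q w.
  by move=> nD0d Wd; rewrite /invariant_free decQ (isotypic_disjoint decY nD0d).
pose I : finType := (Omega * {d : Delta | d \in Delta0}
           + Gamma * {d : Delta | d \notin Delta0})%type.
pose M (i : I) := match i with
  | inl (o, d) => [seq tensv v w | v <- V o, w <- W (val d)]
  | inr (g, d) => [seq tensv (induced toX T u) w | u <- U g, w <- W (val d)]
  end.
have sumM : fullv = (\sum_(i : I) \sum_(S <- M i) S)%VS.
  apply: tensv_span => f h.
  have subM i S : S \in M i -> (S <= \sum_(i : I) \sum_(S <- M i) S)%VS.
    move=> MS; apply: (sumv_sup i) => //; exact: (sumv_seq_sup id).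
  move: {subM} (\sum_(i : I) _)%VS subM => R subM.
  rewrite -tens_rE memv_preim; have := memvf h; rewrite {1}sumW; apply: subvP h.
  apply/subv_sumP=> d _; apply: subv_sum_seqP => w Ww; apply/subvP=> h wh.
  rewrite -memv_preim tens_rE -tens_lE memv_preim; have := memvf f.
  have [D0d|nD0d] := boolP (d \in Delta0).
    rewrite {1}sumV; apply: subvP f; apply/subv_sumP=> o _.
    apply: subv_sum_seqP => v Vv; apply/subvP=> f vf; rewrite -memv_preim tens_lE.
    apply: (subvP (subM (inl (o, Sub d D0d)) (tensv v w) _)); last exact: mem_tensf.
    by apply/allpairsP; exists (v, w).
  rewrite {1}(induced_span trX partP invP A0P stU sumU).
  apply: subvP f; apply/subv_sumP=> k _.
  apply: subv_sum_seqP => u Uu; apply/subvP=> f uf; rewrite -memv_preim tens_lE.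
  apply: (subvP (subM (inr (k, Sub d nD0d)) (tensv (induced toX T u) w) _));
    last exact: mem_tensf.
  by apply/allpairsP; exists (u, w).
split=> //.
- case=> -[o d]; rewrite size_allpairs muln_gt0.
    by have [[-> ->] [-> ->]] := (sizeV o, sizeW (val d)).
  by have [[-> ->] [-> ->]] := (sizeU o, sizeW (val d)).
- case=> -[o d] _ /allpairsP[[v w] /= [Vv Ww ->]].
    apply: (tensv_crested_irreducible P partQ invQ defN trN).
    + exact: irrV Vv.
    + exact: irrW Ww.
    + exact: constW (valP d) Ww.
  apply: (tensv_induced_irreducible trX partP invP partQ defN trN A0P defT).
  + exact: irrU Vv.
  + exact: irrW Ww.
  + exact: subU Vv.
  + exact: freeW (valP d) Ww.
- case=> -[o d] [] [o' d'] _ _ /allpairsP[[v w] /= [Vv Ww ->]]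
    /allpairsP[[v' w'] /= [Vv' Ww' ->]].
  + have [ir ir'] := (irrV _ _ Vv, irrV _ _ Vv').
    have [iw iw'] := (irrW _ _ Ww, irrW _ _ Ww'); split.
      move=> /(tensv_crested_factors ir ir' iw iw')[].
      by move=> /(eqV _ _ _ _ Vv Vv')-> /(eqW _ _ _ _ Ww Ww')/val_inj->.
    case=> oo' dd'; apply: (tensv_crested_equivalent P partQ invQ defN trN) => //.
    * exact: constW (valP d) Ww.
    * exact: constW (valP d') Ww'.
    * exact/(eqV _ _ _ _ Vv Vv').
    * by apply/(eqW _ _ _ _ Ww Ww'); rewrite dd'.
  + split=> //; case/(constant_free_inequivalent partQ defN trN _ _ _ _).
    * by have [] := irrV _ _ Vv.
    * by have [] := irrW _ _ Ww.
    * exact: constW (valP d) Ww.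
    * exact: freeW (valP d') Ww'.
  + have [ir iw] := (irrU _ _ Vv, irrW _ _ Ww).
    have stUW := tensv_induced_stable (N := N) trX partP invP A0P defT
      ir iw (subU _ _ Vv).
    split=> //; case/(free_constant_inequivalent partQ defN trN _ _ stUW).
    * have [u0 stu _] := ir; apply: contraNneq u0 => ind0.
      by rewrite -subv0 -ind0; apply: sub_induced.
    * by have [] := iw.
    * exact: freeW (valP d) Ww.
    * exact: constW (valP d') Ww'.
  + have [ir ir'] := (irrU _ _ Vv, irrU _ _ Vv').
    have [iw iw'] := (irrW _ _ Ww, irrW _ _ Ww').
    have [sub sub'] := (subU _ _ Vv, subU _ _ Vv').
    have [free free'] := (freeW _ _ (valP d) Ww, freeW _ _ (valP d') Ww').
    split.
      move=> /(tensv_induced_factors trX partP invP partQ defN trN A0P defT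
                 ir ir' iw iw' sub sub' free')[].
      by move=> /(eqU _ _ _ _ Vv Vv')-> /(eqW _ _ _ _ Ww Ww')/val_inj->.
    case=> oo' dd'.
    apply: (tensv_induced_equivalent trX partP invP partQ defN trN A0P defT) => //.
      exact/(eqU _ _ _ _ Vv Vv').
    by apply/(eqW _ _ _ _ Ww Ww'); rewrite dd'.
(* The dimensions of the summands with d in Delta0 add up to at most
   #|X| * \dim L(Q), those of the others to at most #|X| * (#|Y| - \dim L(Q)). *)
rewrite directvEgeq /= -[X in (_ <= \dim X)%N]sumM dim_funsp card_prod.
have dimV := isotypic_dim decX; have dimW := isotypic_dim decY.
rewrite !dim_funsp in dimV dimW.
have dimU := sum_dim_induced trX partP invP A0P defT (isotypic_dim decA0).
pose dimWd d := (\sum_(w <- W d) \dim w)%N.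
rewrite big_sumType /= dimW (bigID (mem Delta0)) /= mulnDr; apply: leq_add.
  rewrite -(big_subtype (mem Delta0) dimWd) [X in (_ <= X * _)%N]dimV.
  apply: leq_trans (sum_dim_tensv V (fun d : {d | d \in Delta0} => W (val d))).
  by apply/eq_leq/eq_bigr=> -[o d].
rewrite -(big_subtype (fun d => d \notin Delta0) dimWd).
apply: leq_trans (leq_mul dimU (leqnn _)).
pose indU g := [seq induced toX T u | u <- U g].
rewrite (eq_bigr (fun g => \sum_(u <- indU g) \dim u)%N) => [|g _]; last first.
  by rewrite big_map.
apply: leq_trans (sum_dim_tensv indU (fun d : {d | d \notin Delta0} => W (val d))).
apply/eq_leq/eq_bigr=> -[g d] _ /=.
by rewrite !big_allpairs_dep big_map.
Qed.
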